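(* Let $\mathcal{G}=(V,E)$ be a Borel multi-graph of bounded maximum degree and let $\nu$ be an $F_{\mathcal{E}}$-quasi-invariant Borel probability measure on $E$. Then $\chi_{AP,\nu}(\mathcal{E})\le\Delta(\mathcal{G})+\pi(\mathcal{G})$.
   Context: A Borel multi-graph $\mathcal{G}=(V,E)$ with multiplicity at most $\pi$: $V$ is a standard Borel space and $E\subseteq[V]^2\times[\pi]$ is Borel ($[V]^2$ the unordered pairs of distinct points); $(\{x,y\},k)\in E$ are the parallel edges between $x$ and $y$. $\Delta(\mathcal{G})$ is the maximum degree (with multiplicity), assumed finite, and $\pi(\mathcal{G})$ the maximum multiplicity. The line graph $\mathcal{E}$ is the Borel graph on $E$ in which distinct edges are adjacent iff they share an endpoint. $F_{\mathcal{E}}$ is the equivalence relation on $E$ given by the connected components of $\mathcal{E}$; for $A\subseteq E$, $[A]_{F_\mathcal{E}}$ is its saturation. A Borel probability measure $\nu$ on $E$ is $F_\mathcal{E}$-quasi-invariant if for every Borel $A\subseteq E$, $\nu([A]_{F_\mathcal{E}})=0$ iff $\nu(A)=0$. $\chi_{AP,\nu}(\mathcal{E})$ is the smallest $k$ such that for every $\epsilon>0$ there is a Borel set $C\subseteq E$ with $\nu(C)>1-\epsilon$ and a Borel proper colouring $C\to[k]$ of $\mathcal{E}$ restricted to $C$ (adjacent edges in $C$ receive different colours). *)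

(* Defs.v *)
From Stdlib Require Import Relation_Operators.
From HB Require Import structures.
From mathcomp Require Import all_boot all_order all_algebra.
From mathcomp Require Import all_classical all_reals all_analysis.

Set Implicit Arguments.
Unset Strict Implicit.
Unset Printing Implicit Defensive.
Import Order.TTheory GRing.Theory Num.Theory.
Import numFieldNormedType.Exports.
Local Open Scope classical_set_scope.
Local Open Scope ring_scope.

(* [V] is Borel isomorphic to a Polish space: a complete pseudometric space
   that is Hausdorff is a complete metric space. *)
Definition standard_borel (R : realType) d (V : measurableType d) : Prop :=
  exists (T : completePseudoMetricType R) (f : V -> T),
    [/\ hausdorff_space T,
        (exists2 D : set T, countable D & dense D),
        bijective f &
        forall A : set V, measurable A <-> <<s @open T >> (f @` A)].

(* The sets {x, y}; x = y is allowed only because a [measurableType] has to be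
   inhabited, and [borel_multigraph] excludes these degenerate pairs. *)
Definition upair (V : Type) : Type :=
  [set A : set V | exists x y, A = [set x; y]].

Definition mk_upair (V : Type) (xy : V * V) : upair V :=
  SigSub (mem_set (ex_intro _ xy.1 (ex_intro _ xy.2 erefl))).

Definition upair_display : measure_display -> measure_display.
Proof. exact. Qed.

(* The quotient sigma-algebra of V * V by (x, y) ~ (y, x). *)
Definition upair_measurable d (V : measurableType d) : set (set (upair V)) :=
  image_set_system setT (@mk_upair V) measurable.

Section upair_measurableType.
Context d (V : measurableType d).

Let upair_sigma_algebra : sigma_algebra setT (@upair_measurable d V).
Proof. exact/sigma_algebra_image/sigma_algebra_measurable. Qed.

Let upair_measurable0 : @upair_measurable d V set0.
Proof. by case: upair_sigma_algebra. Qed.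

Let upair_measurableC A :
  @upair_measurable d V A -> @upair_measurable d V (~` A).
Proof. by case: upair_sigma_algebra => _ + _ => /[apply]; rewrite setTD. Qed.

Let upair_measurable_bigcup (F : (set (upair V))^nat) :
  (forall i, @upair_measurable d V (F i)) ->
  @upair_measurable d V (\bigcup_i F i).
Proof. by case: upair_sigma_algebra => _ _; apply. Qed.

HB.instance Definition _ := Choice.on (upair V).
HB.instance Definition _ := isPointed.Build (upair V) (mk_upair (point, point)).
HB.instance Definition _ := @isMeasurable.Build (upair_display d) (upair V)
  (@upair_measurable d V) upair_measurable0 upair_measurableC
  upair_measurable_bigcup.

End upair_measurableType.

(* The labels [p] are the naturals k < p. *)
Record borel_multigraph d (V : measurableType d) (p : nat) := BorelMultigraph {
  edges : set (upair V * nat) ;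
  edges_measurable : measurable edges ;
  edges_loopless : forall e, edges e ->
    exists x y, x <> y /\ val e.1 = [set x; y] ;
  edges_label : forall e, edges e -> (e.2 < p)%N }.

Section multigraph.
Context d (V : measurableType d) (p : nat) (E : borel_multigraph V p).
Implicit Types (e f : upair V * nat) (A C : set (upair V * nat)).

Definition endpoint e : set V := val e.1.

Section parameters.
Context (R : realType).
Local Open Scope ereal_scope.

Definition degree (x : V) : \bar R :=
  counting [set e | edges E e /\ endpoint e x].

Definition max_degree : \bar R := ereal_sup [set degree x | x in setT].

Definition multiplicity (a : upair V) : \bar R :=
  counting [set k : nat | edges E (a, k)].

Definition max_multiplicity : \bar R :=
  ereal_sup [set multiplicity a | a in setT].

End parameters.

Definition line_adj e f : Prop :=
  [/\ edges E e, edges E f, e <> f & exists x, endpoint e x /\ endpoint f x].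

Definition line_connected e f : Prop :=
  [/\ edges E e, edges E f & clos_refl_trans _ line_adj e f].

Definition saturation A : set (upair V * nat) :=
  [set f | exists2 e, A e & line_connected e f].

Section measured.
Context (R : realType) (nu : probability (upair V * nat)%type R).
Local Open Scope ereal_scope.

(* Saturations of Borel sets are Borel when the line graph is locally countable
   (Lusin-Novikov), so that [nu (saturation A)] is meaningful. *)
Definition quasi_invariant : Prop :=
  forall A, measurable A -> A `<=` edges E ->
    nu (saturation A) = 0 <-> nu A = 0.

Definition ap_colorable : set nat := [set k |
  forall eps : R, (0 < eps)%R ->
    exists C (c : upair V * nat -> nat),
      [/\ measurable C, C `<=` edges E & (1 - eps)%:E < nu C] /\
      [/\ measurable_fun C c,
          forall e, C e -> (c e < k)%N &
          forall e f, C e -> C f -> line_adj e f -> c e <> c f]].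

(* The infimum of a set of naturals in \bar R is its least element, or +oo if
   the set is empty. *)
Definition chi_AP : \bar R := ereal_inf [set k%:R%:E | k in ap_colorable].

End measured.
End multigraph.

Arguments max_degree {d V p} E R.
Arguments max_multiplicity {d V p} E R.

(* Main.v *)
(* All but a small part of the edge set [E] is a subgraph that is compact
   for a countable code of the points, in which the neighbourhood of a Borel
   set of edges is Borel, and whose edges carry finitely many labels that
   are distinct inside balls of a fixed large radius. Take a Borel partial
   colouring of this subgraph whose set of uncoloured edges (holes) has
   nearly minimal measure. By Vizing's argument every hole starts a chain (a
   fan, then a two-coloured path) along which it can be shifted, and the
   chain either ends where the hole can be coloured or has length at least
   [L]. There are finitely many types of chains, a type being the sequence
   of labels and colours, and the holes of one type can be moved
   simultaneously. By near-minimality, holes of terminating types have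
   almost no measure, and shifting the holes of a long type by [i] steps
   almost never decreases their measure. As an edge lies on a number of
   chains bounded independently of [L], the measure of the holes is O(1/L). *)
Require Import Defs.
From mathcomp Require Import all_boot all_order all_algebra.
From mathcomp Require Import all_classical all_reals all_analysis.
From mathcomp Require Import measurable_realfun unstable.
From mathcomp Require Import zify lra.

Set Implicit Arguments.
Unset Strict Implicit.
Unset Printing Implicit Defensive.
Local Open Scope classical_set_scope.

(** * Graphs of maximum degree two *)

(** The obstacle is measurability: moving holes requires Borel neighbourhoods of Borel sets of
    edges, a statement of Lusin-Novikov type. As the colouring may leave out a set of small measure,
    it suffices to have it where closed sets have measurable images by compactness and finite fibres
    reduce general Borel images to injective ones. Compactness is expressed by limits along a fixed
    ultrafilter instead of subsequences. A second obstacle is that the infimum of the hole measures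
    need not be attained. The number of chain types does not depend on the colouring, so the
    tolerance of near-minimality can be chosen after it, and the errors of all types together stay
    bounded. The bound on the chains through an edge ignores their length because an edge of a
    two-coloured path remembers where the path starts: the two colours and one of the at most two
    ends of its component recover the first path edge, and the hole is two adjacency steps away. *)

Section Degree2.
Context (T : choiceType) (H : T -> T -> Prop).

Definition max_degree2 := forall a b c d,
  H a b -> H a c -> H a d -> b <> c -> b <> d -> c = d.

Definition pendant a := forall b c, H a b -> H a c -> b = c.

Definition brel : rel T := fun x y => `[< H x y >].

Definition linked a b := exists2 s, path brel a s & last a s = b.

Lemma linked_refl a : linked a a. Proof. by exists [::]. Qed.

Lemma linked_step a b : H a b -> linked a b.
Proof. by move=> Hab; exists [:: b] => //=; rewrite andbT; apply/asboolP. Qed.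

Lemma linked_trans b a c : linked a b -> linked b c -> linked a c.
Proof.
move=> [s ps <-] [t pt <-]; exists (s ++ t); last by rewrite last_cat.
by rewrite cat_path ps.
Qed.

Hypothesis H_sym : forall a b, H a b -> H b a.

Lemma linked_sym a b : linked a b -> linked b a.
Proof.
move=> [s + <-]; elim: s a => [|x s IH] a /=; first by exists [::].
move=> /andP[/asboolP Hax /IH]; move=> /linked_trans; apply.
exact/linked_step/H_sym.
Qed.

Hypothesis H_deg : max_degree2.

(** Coming from [p], a simple path can leave [a] in at most one way, because [H] has degree at most
    two. If one path stops at [a], pendancy forces the next vertex of the other to be [p], which
    simplicity excludes. *)
Lemma pendant_path_uniq s s' p a : H a p ->
  uniq (p :: a :: s) -> uniq (p :: a :: s') ->
  path brel a s -> path brel a s' ->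
  pendant (last a s) -> pendant (last a s') -> last a s = last a s'.
Proof.
elim: s s' p a => [|c s IH] [|c' s'] p a Hap //=.
- move=> _ + _ /andP[/asboolP Hac _] pa _.
  by rewrite !inE (pa _ _ Hap Hac) eqxx orbT.
- move=> + _ /andP[/asboolP Hac _] _ _ pa.
  by rewrite !inE (pa _ _ Hap Hac) eqxx orbT.
move=> u u' /andP[/asboolP Hac pcs] /andP[/asboolP Hac' pcs'].
have cc' : c = c'.
  apply: (H_deg Hap Hac Hac').
    by move=> pc; move: u; rewrite pc !inE eqxx orbT.
  by move=> pc; move: u'; rewrite pc !inE eqxx orbT.
rewrite -cc' in u' pcs' *.
by apply: (IH s' a c _ _ _ pcs pcs'); [exact: H_sym | case/andP: u | case/andP: u'].
Qed.

(* Simple paths issued from a pendant point are forced, so two of them ending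
   at pendant points have the same end. *)
Lemma pendant_linked_uniq a b b' : pendant a -> pendant b -> pendant b' ->
  a <> b -> a <> b' -> linked a b -> linked a b' -> b = b'.
Proof.
move=> pa + + + + [s ps sb] [s' ps' sb'].
rewrite -{}sb -{}sb'.
case/shortenP: ps => p1 q1 u _; case/shortenP: ps' => p2 q2 u' _.
move: p1 q1 u p2 q2 u' => {}s ps u {}s' ps' u'.
case: s ps u => [|x s] //= /andP[/asboolP Hax pxs] u.
case: s' ps' u' => [|x' s'] //= /andP[/asboolP Hax' pxs'] u'.
rewrite -(pa _ _ Hax Hax') in u' pxs' * => pb pb' _ _.
exact: (pendant_path_uniq (H_sym Hax)).
Qed.

End Degree2.

(** * Shift chains in multigraphs *)

Lemma size_fibers (A B : eqType) (g : A -> B) m (F : seq A) (Y : seq B) :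
  (forall f, f \in F -> g f \in Y) ->
  (forall y, y \in Y -> size [seq f <- F | g f == y] <= m) ->
  size F <= m * size Y.
Proof.
elim: Y F => [|y Y IH] F gY fib.
  by case: F gY {fib} => // f F /(_ f); rewrite mem_head => /(_ isT).
rewrite -(count_predC (fun f => g f == y) F) mulnS leq_add//.
  by rewrite -size_filter fib// mem_head.
rewrite -size_filter; apply: IH => [f|z zY].
  rewrite mem_filter /= => /andP[fy fF].
  by have := gY _ fF; rewrite inE (negbTE fy).
rewrite -filter_predI (leq_trans _ (fib z _))//; last by rewrite inE zY orbT.
by rewrite !size_filter; apply: sub_count => f /= /andP[].
Qed.

Lemma mem_bigcup_seq (I : finType) (B : Type) (A : B -> {set I}) (Y : seq B) i :
  (i \in (\bigcup_(y <- Y) A y)%SET) = has (fun y => i \in A y) Y.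
Proof. by elim: Y => [|y Y IH]; rewrite ?big_nil ?big_cons ?inE ?IH. Qed.

Lemma size_disjoint_family (I : finType) (B : eqType) (A : B -> {set I}) m
    (Y : seq B) : uniq Y -> (forall y, m <= #|A y|) ->
  (forall y y' i, y \in Y -> y' \in Y -> i \in A y -> i \in A y' -> y = y') ->
  m * size Y <= #|(\bigcup_(y <- Y) A y)%SET|.
Proof.
move=> + mA; elim: Y => [|y Y IH] /=; first by rewrite muln0.
move=> /andP[yY uY] dis; rewrite big_cons mulnS cardsU.
have -> : (A y :&: \bigcup_(y <- Y) A y)%SET = finset.set0.
  apply/setP => i; rewrite !inE; apply/negP => /andP[iy].
  rewrite mem_bigcup_seq => /hasP[z zY iz].
  by move: yY; rewrite (dis y z i)// ?zY// inE ?eqxx ?zY ?orbT.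
rewrite cards0 subn0 leq_add//; apply: IH => // a b i aY bY.
by apply: dis; rewrite inE ?aY ?bY orbT.
Qed.

(** The covering list may repeat elements and contain points outside [P], so bounds pass to subsets
    and unions without an exact enumeration of [P]. *)
Definition small (T : eqType) n (P : set T) :=
  exists s : seq T, size s <= n /\ forall x, P x -> x \in s.

Lemma small_sub (T : eqType) n (P Q : set T) :
  (forall x, P x -> Q x) -> small n Q -> small n P.
Proof. by move=> PQ [s [sn sQ]]; exists s; split=> // x /PQ/sQ. Qed.

Lemma small_union (T : eqType) n m (P Q : set T) : small n P -> small m Q ->
  small (n + m) [set x | P x \/ Q x].
Proof.
move=> [s [sn sP]] [t [tm tQ]]; exists (s ++ t); rewrite size_cat leq_add//.
by split=> // x [/sP|/tQ]; rewrite mem_cat => ->; rewrite ?orbT.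
Qed.

Lemma small_bind (T U : eqType) n m (P : set T) (Q : T -> set U) : small n P ->
  (forall x, P x -> small m (Q x)) -> small (n * m) [set y | exists x, P x /\ Q x y].
Proof.
move=> [s [sn sP]] sQ.
have /choice[t tP] x : exists t : seq U, P x ->
    size t <= m /\ forall y, Q x y -> y \in t.
  by have [/sQ[t tP]|nP] := pselect (P x); [exists t | exists [::]].
exists (flatten [seq t x | x <- s & `[< P x >]]); split; last first.
  move=> y [x [Px Qxy]]; apply/flatten_mapP; exists x.
    by rewrite mem_filter sP// andbT; apply/asboolP.
  by have [_] := tP x Px; exact.
apply: (@leq_trans (size [seq x <- s | `[< P x >]] * m)).
  elim: s {sn sP} => //= x s IH; case: ifP => // /asboolP Px /=.
  by rewrite size_cat mulSn leq_add//; have [] := tP x Px.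
by rewrite leq_mul2r (leq_trans _ sn) ?orbT// size_filter count_size.
Qed.

(** * Multigraphs given by two endpoint maps, and missing colours *)

Section Multigraph.
Context (V Z : choiceType) (ea eb : Z -> V).
Implicit Types (z f e : Z) (u v x y : V).

Definition inc z v := ea z = v \/ eb z = v.

Definition adj z z' := exists v, inc z v /\ inc z' v.

Definition other z v := if ea z == v then eb z else ea z.

(* A value [>= K] means that the edge is uncoloured (a hole). *)
Definition proper_on (K : nat) (E : set Z) (c : Z -> nat) :=
  forall z z', E z -> E z' -> adj z z' -> z <> z' -> c z = c z' -> K <= c z.

Lemma adj_sym z z' : adj z z' -> adj z' z.
Proof. by move=> [v [? ?]]; exists v. Qed.

Lemma adj_refl z : adj z z.
Proof. by exists (ea z); split; left. Qed.

Lemma inc_other z v : inc z v -> inc z (other z v).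
Proof. by rewrite /inc /other; case: eqP => [_|_ _]; [right | left]. Qed.

Lemma inc_eq z v w : inc z v -> inc z w -> w = v \/ w = other z v.
Proof.
rewrite /inc /other; case: eqP => [->|av [/av//|<-]].
  by move=> _ [->|->]; [left | right].
by case=> ->; [right | left].
Qed.

Lemma other_neq z v : ea z <> eb z -> inc z v -> other z v <> v.
Proof.
rewrite /inc /other => ll; case: (eqVneq (ea z) v) => [<- _ /esym//|av _].
by apply/eqP.
Qed.

Context (Delta mu : nat) (E : set Z).
Hypothesis loopless : forall z, E z -> ea z <> eb z.
Hypothesis degE : forall v, exists s : seq Z,
  size s <= Delta /\ forall z, E z -> inc z v -> z \in s.
Hypothesis multE : forall v w, v <> w -> exists s : seq Z,
  size s <= mu /\ forall z, E z -> inc z v -> inc z w -> z \in s.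

Let K := Delta + mu.

Context (c : Z -> nat).
Hypothesis c_proper : proper_on K E c.

Lemma color_inj v f g : E f -> E g -> inc f v -> inc g v -> c f < K ->
  c f = c g -> f = g.
Proof.
move=> Ef Eg fv gv fK fg; apply: contrapT => nfg.
by have := c_proper Ef Eg (ex_intro _ v (conj fv gv)) nfg fg; rewrite leqNgt fK.
Qed.

Definition missing v a := a < K /\ forall z, E z -> inc z v -> c z <> a.

Definition missing_set v : {set 'I_K} := [set a : 'I_K | `[< missing v a >]]%SET.

Lemma mem_missing v (a : 'I_K) : a \in missing_set v -> missing v a.
Proof. by rewrite inE => /asboolP. Qed.

Lemma card_missing v : mu <= #|missing_set v|.
Proof.
have [s [sD sE]] := degE v.
have sub : (~: missing_set v)%SET \subset [set a : 'I_K | val a \in map c s]%SET.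
  apply/fintype.subsetP => a; rewrite !inE => /asboolPn na; apply: contrapT => nin.
  apply: na; split=> // z Ez zv cz; apply: nin.
  have -> : val a = c z by [].
  exact/map_f/sE.
have card_s : #|[set a : 'I_K | val a \in map c s]%SET| <= Delta.
  rewrite cardE (leq_trans _ sD)// -(size_map val) -(size_map c).
  apply: uniq_leq_size; first by rewrite map_inj_uniq ?enum_uniq//; exact: val_inj.
  by move=> _ /mapP[a + ->]; rewrite mem_enum inE.
have := leq_trans (subset_leq_card sub) card_s.
by rewrite [#|missing_set v|]cardsCs card_ord /K; lia.
Qed.

(** * Vizing fans at an endpoint of a hole *)

Section Fan.
Context (e0 : Z) (x : V).
Hypotheses (Ee0 : E e0) (e0x : inc e0 x) (ce0 : K <= c e0).

(** A hole at [f] can move on to [g]: the colour of [g] is free at the outer end of [f], and becomes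
    free at [x] once [g] is uncoloured. Fans are the paths of this relation, and [linked] collects
    all their edges at once. *)
Definition fan_step f g :=
  [/\ E g, inc g x, c g < K & missing (other f x) (c g)].

Lemma mult_gt0 : 0 < mu.
Proof.
have [s [sm sE]] := multE (loopless Ee0).
have := sE _ Ee0 (or_introl erefl) (or_intror erefl).
by case: s sm {sE} => //= a s sm _; exact: leq_trans sm.
Qed.

Lemma missing_ex v : exists a, missing v a.
Proof.
have := leq_trans mult_gt0 (card_missing v); rewrite card_gt0 => /set0Pn[a].
by move=> /mem_missing ?; exists a.
Qed.

Lemma linked_fan f : linked fan_step e0 f -> E f /\ inc f x.
Proof.
move=> [s + <-]; case/lastP: s => //= s g; rewrite last_rcons.
by rewrite rcons_path => /andP[_ /asboolP[]].
Qed.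

(** Otherwise the outer ends [Y] of the reachable edges [F] have disjoint sets of missing colours,
    each of size at least [mu], while at most [mu] edges of [F] share an outer end; so the union of
    these sets has at least as many colours as [F] has edges. But each of these colours occurs at
    [x] on an edge that is again reachable and differs from the uncoloured [e0], so there is at
    least one colour less. *)
Lemma fan_common_color :
  (forall f a, linked fan_step e0 f -> missing (other f x) a -> ~ missing x a) ->
  exists f f' b, [/\ linked fan_step e0 f, linked fan_step e0 f',
    other f x <> other f' x, missing (other f x) b & missing (other f' x) b].
Proof.
move=> H; apply: contrapT => H'.
have [s [_ sE]] := degE x.
pose F := undup [seq f <- s | `[< linked fan_step e0 f >]].
have FP f : (f \in F) = `[< linked fan_step e0 f >].
  rewrite mem_undup mem_filter; apply/andP/idP => [[]//|Hf]; split=> //.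
  by move/asboolP: Hf => /linked_fan[Ef fx]; exact: sE.
have uF : uniq F by exact: undup_uniq.
pose Y := undup [seq other f x | f <- F].
have uY : uniq Y by exact: undup_uniq.
have FY : size F <= mu * size Y.
  apply: (@size_fibers _ _ (other^~ x)) => [f fF|y].
    by rewrite mem_undup; apply/mapP; exists f.
  rewrite mem_undup => /mapP[f]; rewrite FP => /asboolP/linked_fan[Ef fx] yf.
  have [t [tm tE]] := multE (other_neq (loopless Ef) fx).
  rewrite (leq_trans _ tm)//; apply: uniq_leq_size; first exact: filter_uniq.
  move=> g; rewrite mem_filter FP => /andP[/eqP gy /asboolP/linked_fan[Eg gx]].
  by apply: tE => //; rewrite -yf -gy; exact: inc_other.
have YF : mu * size Y <= #|(\bigcup_(y <- Y) missing_set y)%SET|.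
  apply: size_disjoint_family => // [y|y y' a]; first exact: card_missing.
  rewrite !mem_undup => /mapP[f + ->] /mapP[f' + ->].
  rewrite !FP => /asboolP lf /asboolP lf' /mem_missing ma /mem_missing ma'.
  by apply: contrapT => ff'; apply: H'; exists f, f', a.
have e0F : e0 \in F by rewrite FP; apply/asboolP/linked_refl.
suff : #|(\bigcup_(y <- Y) missing_set y)%SET| <= size (rem e0 F).
  rewrite size_rem//; have : 0 < size F by case: (F) e0F.
  lia.
rewrite cardE -(size_map c) -(size_map val); apply: uniq_leq_size.
  by rewrite map_inj_uniq ?enum_uniq//; exact: val_inj.
move=> _ /mapP[a + ->]; rewrite mem_enum mem_bigcup_seq => /hasP[y].
rewrite mem_undup => /mapP[f]; rewrite FP => /asboolP lf -> /mem_missing ma.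
have /not_andP[|] := H f a lf ma; first by case: ma.
move=> /existsNP[g /not_implyP[Eg /not_implyP[gx /contrapT cg]]].
apply/mapP; exists g => //; rewrite rem_filter// mem_filter /= FP; apply/andP; split.
  by apply/eqP => ge; move: ce0; rewrite -ge cg leqNgt ltn_ord.
apply/asboolP/(linked_trans lf)/linked_step; split; rewrite ?cg//.
Qed.
End Fan.

(** The colours after [i] moves of the hole. At the [i]-th edge, which is then the hole, the old
    colour is still returned; [sc_free] and [sc_last] leave this edge out. *)
Definition shifted (es : seq Z) i f :=
  if index f es < i then c (nth f es (index f es).+1) else c f.

Lemma shiftedP z0 es i f : uniq es -> i < size es ->
  (exists2 k, k < i & f = nth z0 es k /\ shifted es i f = c (nth z0 es k.+1)) \/
  ((forall k, k < i -> f <> nth z0 es k) /\ shifted es i f = c f).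
Proof.
move=> u il; rewrite /shifted; case: ltnP => [lt_fi|le_if]; [left|right].
  have fes : f \in es by rewrite -index_mem (ltn_trans lt_fi).
  exists (index f es) => //; rewrite nth_index//; split=> //.
  by congr c; apply: set_nth_default; exact: leq_ltn_trans il.
split=> // k ki fk; move: le_if; rewrite fk index_uniq ?(ltn_trans ki)//.
by rewrite leqNgt ki.
Qed.

(* Moving the hole from [e0] along [es] keeps a proper partial colouring at
   every stage: at stage [i] the hole is the [i]-th edge and the previous ones
   have received the colour of their successor. *)
Record shift_chain L e0 es j al be : Prop := ShiftChain {
  sc_uniq : uniq es ;
  sc_size : 0 < size es <= Delta + L ;
  sc_fan_size : j < size es ;
  sc_albe_le : al <= K /\ be <= K ;
  sc_head : nth e0 es 0 = e0 ;
  sc_edge : forall i, i < size es -> E (nth e0 es i) ;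
  sc_adj : forall i, i.+1 < size es -> adj (nth e0 es i) (nth e0 es i.+1) ;
  sc_col : forall i, i.+1 < size es -> c (nth e0 es i.+1) < K ;
  sc_free : forall i f, i.+1 < size es -> E f -> adj f (nth e0 es i) ->
    f <> nth e0 es i -> f <> nth e0 es i.+1 ->
    shifted es i f <> c (nth e0 es i.+1) ;
  sc_last : L < size es \/ exists2 g, g < K & forall f, E f ->
    adj f (nth e0 es (size es).-1) -> f <> nth e0 es (size es).-1 ->
    shifted es (size es).-1 f <> g ;
  sc_fan : forall i, i <= j -> i < size es -> adj (nth e0 es i) e0 ;
  sc_alt : forall i, j < i -> i < size es ->
    c (nth e0 es i) = if odd (i - j.+1) then be else al ;
  sc_albe : j.+1 < size es -> [/\ al < K, be < K & al <> be] ;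
  sc_start : j.+1 < size es -> forall f f', E f -> E f' ->
    adj f (nth e0 es j.+1) -> adj f' (nth e0 es j.+1) ->
    c f = be -> c f' = be -> f = f' }.

(** * Paths alternating between two colours *)

Section Alternating.
Context (al be : nat).
Hypotheses (alK : al < K) (beK : be < K) (albe : al <> be).

Definition alt_link u v := exists z,
  [/\ E z, c z = al \/ c z = be, inc z u, inc z v & u <> v].

Lemma alt_link_sym u v : alt_link u v -> alt_link v u.
Proof. by move=> [z [? ? ? ? uv]]; exists z; split=> // /esym. Qed.

Lemma alt_color_lt z : c z = al \/ c z = be -> c z < K.
Proof. by case=> ->. Qed.

(** Each of the two colours occurs on at most one edge at a vertex, so among three such edges two
    coincide. *)
Lemma alt_link_deg2 : max_degree2 alt_link.
Proof.
have oth z a b : inc z a -> inc z b -> a <> b -> b = other z a.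
  by move=> za zb ab; case: (inc_eq za zb) => // /esym.
move=> a b b' d [z1 [E1 c1 a1 b1 n1]] [z2 [E2 c2 a2 b2 n2]].
move=> [z3 [E3 c3 a3 b3 n3]] bb' bd.
have n12 : c z1 <> c z2.
  move=> e12; apply: bb'; rewrite (oth _ _ _ a1 b1 n1) (oth _ _ _ a2 b2 n2).
  by rewrite (color_inj E1 E2 a1 a2 (alt_color_lt c1) e12).
have n13 : c z1 <> c z3.
  move=> e13; apply: bd; rewrite (oth _ _ _ a1 b1 n1) (oth _ _ _ a3 b3 n3).
  by rewrite (color_inj E1 E3 a1 a3 (alt_color_lt c1) e13).
have e23 : c z2 = c z3 by move: n12 n13; case: c1 c2 c3 => -> [] -> [] ->.
rewrite (oth _ _ _ a2 b2 n2) (oth _ _ _ a3 b3 n3).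
by rewrite (color_inj E2 E3 a2 a3 (alt_color_lt c2) e23).
Qed.

Lemma missing_pendant v : missing v al \/ missing v be -> pendant alt_link v.
Proof.
move=> mv b b' [z1 [E1 c1 a1 b1 n1]] [z2 [E2 c2 a2 b2 n2]].
have e12 : c z1 = c z2.
  by move: c1 c2; case: mv => -[_ mv] [] e1 [] e2; move: (mv _ E1 a1) (mv _ E2 a2);
    rewrite e1 e2.
move: b1 b2; rewrite (color_inj E1 E2 a1 a2 (alt_color_lt c1) e12) => b1 b2.
case: (inc_eq a2 b1) => [/esym//|->]; case: (inc_eq a2 b2) => [/esym//|->] //.
Qed.

Definition alt_color i := if odd i then be else al.

Lemma alt_color_ltK i : alt_color i < K.
Proof. by rewrite /alt_color; case: ifP. Qed.

Lemma alt_color_inj i j : alt_color i = alt_color j -> odd i = odd j.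
Proof. by rewrite /alt_color; do 2 case: odd => //; move=> /esym. Qed.

Lemma alt_color_odd i j : odd i = odd j -> alt_color i = alt_color j.
Proof. by rewrite /alt_color => ->. Qed.

Lemma alt_colorP i : alt_color i = al \/ alt_color i = be.
Proof. by rewrite /alt_color; case: odd; [right | left]. Qed.

Section Path.
Context (e0 : Z) (y : V).
Hypothesis y_be : missing y be.

(** The default [e0] is returned when the colour is missing at [v]; the walk is used only below [l],
    where [l_present] excludes this. *)
Definition color_edge a v := xget e0 [set z | [/\ E z, inc z v & c z = a]].

Fixpoint alt_vertex i : V := if i is i'.+1 then
  other (color_edge (alt_color i') (alt_vertex i')) (alt_vertex i') else y.

Definition alt_edge i := color_edge (alt_color i) (alt_vertex i).

Context (l : nat).
Hypothesis l_present : forall i, i < l -> ~ missing (alt_vertex i) (alt_color i).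

Lemma alt_edgeP i : i < l -> [/\ E (alt_edge i), inc (alt_edge i) (alt_vertex i),
  inc (alt_edge i) (alt_vertex i.+1) & c (alt_edge i) = alt_color i].
Proof.
move=> il; have /not_andP[|] := l_present il; first by rewrite alt_color_ltK.
move=> /existsNP[z /not_implyP[Ez /not_implyP[zv /contrapT cz]]].
suff [? ? ?] : [/\ E (alt_edge i), inc (alt_edge i) (alt_vertex i) &
    c (alt_edge i) = alt_color i].
  by split=> //=; exact: inc_other.
by rewrite /alt_edge /color_edge; case: xgetP => [_ -> //|/(_ z)[]].
Qed.

Lemma alt_vertex_neq i : i < l -> alt_vertex i.+1 <> alt_vertex i.
Proof. by move=> /alt_edgeP[Ei iv _ _]; exact: other_neq (loopless Ei) iv. Qed.

Lemma alt_edge_color_inj i f v : i < l -> E f -> inc f v -> inc (alt_edge i) v ->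
  c f = alt_color i -> f = alt_edge i.
Proof.
move=> /alt_edgeP[Ei _ _ ci] Ef fv iv fi.
by apply: (color_inj Ef Ei fv iv); rewrite ?fi ?alt_color_ltK.
Qed.

(** A repeated edge makes the walk return to an earlier vertex. Comparing edges of equal colour
    there gives a loop, an earlier repetition or, at the start, an edge of colour [be] at [y], where
    this colour is missing. *)
Lemma alt_edge_inj i k : k < i -> i < l -> alt_edge k <> alt_edge i.
Proof.
elim: i k => // m IH k km ml ek.
have [Em ma mb cm] := alt_edgeP (ltnW ml).
have [En na _ cn] := alt_edgeP ml.
have [Ek ka kb ck] := alt_edgeP (ltn_trans km ml).
have /= okn : odd k = odd m.+1 by apply: alt_color_inj; rewrite -ck -cn ek.
have {}km : k < m.
  rewrite ltn_neqAle -ltnS km andbT; apply/eqP => e.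
  by move: okn; rewrite e; case: odd.
rewrite -ek in na; case: (inc_eq ka na) => [w|]; last first.
  rewrite -[other _ _]/(alt_vertex k.+1) => w.
  have [Ek1 k1a k1b ck1] := alt_edgeP (leq_ltn_trans km (ltnW ml)).
  have e : alt_edge k.+1 = alt_edge m.
    apply: (alt_edge_color_inj (ltnW ml) Ek1 k1a); first by rewrite -w.
    by rewrite ck1; apply: alt_color_odd; rewrite /= okn negbK.
  move: km; rewrite leq_eqVlt => /orP[/eqP k1m|k1m].
    by apply: (alt_vertex_neq (ltnW ml)); rewrite w k1m.
  exact: IH k1m (ltnW ml) e.
case: k okn km ka kb ck ek w na Ek => [om _ _ _ _ _ w _ _|k].
  case: y_be => _ /(_ _ Em); rewrite -[y]/(alt_vertex 0) -w cm; apply => //.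
  by rewrite /alt_color -[odd m]negbK -om.
move=> okm km ka kb ck ek w na Ek.
have [Ek0 k0a k0b ck0] := alt_edgeP (ltn_trans (ltnW km) (ltnW ml)).
apply: (IH k (ltnW km) (ltnW ml)).
apply: (alt_edge_color_inj (ltnW ml) Ek0 k0b); first by rewrite w in mb.
by rewrite ck0; apply: alt_color_odd; move: okm => /=; case: (odd k); case: (odd m).
Qed.

Lemma alt_vertex_linked i : i <= l -> linked alt_link y (alt_vertex i).
Proof.
elim: i => [|i IH] il; first exact: linked_refl.
apply: (linked_trans (IH (ltnW il))); apply: linked_step.
have [Ei ia ib ci] := alt_edgeP il; exists (alt_edge i); split => //.
  by rewrite ci; exact: alt_colorP.
by move=> /esym; exact: alt_vertex_neq.
Qed.

Lemma alt_edge_linked i v : i < l -> inc (alt_edge i) v -> linked alt_link y v.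
Proof.
move=> il iv; have [_ ia ib _] := alt_edgeP il.
case: (inc_eq ia iv) => ->; first exact: alt_vertex_linked (ltnW il).
by rewrite -[other _ _]/(alt_vertex i.+1); exact: alt_vertex_linked.
Qed.

End Path.
End Alternating.

(** * Shift chains made of a fan and an alternating path *)

Section Chain.
Context (L : nat) (e0 : Z) (x : V).
Hypotheses (Ee0 : E e0) (e0x : inc e0 x) (ce0 : K <= c e0).

Lemma fan_path s : path (brel (fan_step x)) e0 s ->
  [/\ forall i, i <= size s -> E (nth e0 (e0 :: s) i) /\ inc (nth e0 (e0 :: s) i) x,
      forall i, i < size s -> c (nth e0 (e0 :: s) i.+1) < K &
      forall i, i < size s ->
        missing (other (nth e0 (e0 :: s) i) x) (c (nth e0 (e0 :: s) i.+1))].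
Proof.
move=> /(pathP e0) ps.
have step i : i < size s -> fan_step x (nth e0 (e0 :: s) i) (nth e0 (e0 :: s) i.+1).
  by move=> /ps /asboolP.
split=> [[|i] is'|i is'|i is'] //; by case: (step _ is').
Qed.

Lemma fan_size s : path (brel (fan_step x)) e0 s -> uniq (e0 :: s) ->
  size s < Delta.
Proof.
move=> /fan_path[FE _ _] u; have [t [tD tE]] := degE x.
rewrite (leq_trans _ tD)// -/(size (e0 :: s)); apply: uniq_leq_size => // f.
move=> /(nthP e0)[i]; rewrite /= ltnS => /FE[Ef fx] <-; exact: tE.
Qed.

Lemma adj_fan s i : path (brel (fan_step x)) e0 s -> i <= size s ->
  adj (nth e0 (e0 :: s) i) e0.
Proof. by move=> /fan_path[FE _ _] /FE[_ ix]; exists x. Qed.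

(* Shifting the fan prefix keeps the set of colours at [x] and uses at each
   other end of the fan a colour that was missing there. *)
Lemma fan_shifted s t i f a : path (brel (fan_step x)) e0 s ->
    uniq (e0 :: s ++ t) -> i <= size s -> E f ->
    f <> nth e0 (e0 :: s) i -> a < K ->
    missing (other (nth e0 (e0 :: s) i) x) a ->
    (forall k, k < i -> c (nth e0 (e0 :: s) k.+1) <> a) ->
    adj f (nth e0 (e0 :: s) i) ->
    shifted (e0 :: s ++ t) i f = a -> inc f x /\ c f = a.
Proof.
move=> ps u is' Ef fi aK [_ ma] na [w [fw iw]].
have [FE _ _] := fan_path ps.
have nthE k : k <= size s -> nth e0 (e0 :: s ++ t) k = nth e0 (e0 :: s) k.
  by move=> ks; rewrite -cat_cons nth_cat /= ltnS ks.
have [|[k ki [-> ->]]|[_ ->]] := shiftedP e0 f u (i := i).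
- by rewrite /= ltnS size_cat (leq_trans is')// leq_addr.
- by rewrite nthE ?(leq_trans ki)// => /(na _ ki).
move=> fa; split=> //; have [Ei ix] := FE i is'.
case: (inc_eq ix iw) => wx; first by rewrite -wx.
by case: (ma f Ef) => //; rewrite -wx.
Qed.

(** Once the fan is shifted, [a] is still free at both ends of its last edge, so the hole there can
    be filled. *)
Lemma fan_terminal s a : path (brel (fan_step x)) e0 s -> uniq (e0 :: s) ->
  missing (other (last e0 s) x) a -> missing x a ->
  exists es j al be, shift_chain L e0 es j al be.
Proof.
move=> ps u mla mxa; have [FE FK Fm] := fan_path ps; have sD := fan_size ps u.
have u0 : uniq (e0 :: s ++ [::]) by rewrite cats0.
(* There is no path part: [j] is the last index, and the zeros for [al] and [be] only fill the
   argument places. *)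
exists (e0 :: s), (size s), 0, 0; split=> //=.
- exact: leq_trans sD (leq_addr _ _).
- by move=> i; rewrite ltnS => /FE[].
- move=> i; rewrite ltnS => is'.
  by exists x; split; [have [] := FE i (ltnW is') | have [] := FE i.+1 is'].
- move=> i f; rewrite ltnS => is' Ef fa fi fi1; rewrite -[e0 :: s]cats0 cat_cons => fs.
  have [|fx cf] := fan_shifted ps u0 (ltnW is') Ef fi (FK _ is') (Fm _ is') _ fa fs.
    move=> k ki ek.
    have ks := leq_trans ki (ltnW is').
    have /eqP := color_inj (FE _ ks).1 (FE _ is').1 (FE _ ks).2 (FE _ is').2
      (FK k ks) ek.
    by rewrite nth_uniq//= ?ltnS// eqSS => /eqP e; rewrite e ltnn in ki.
  apply: fi1; have [Ei ix] := FE _ is'.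
  by apply: (color_inj Ef Ei fx ix); rewrite cf ?FK.
- right; exists a => [|f Ef fa fl fs]; first by case: mxa.
  rewrite -[e0 :: s]cats0 cat_cons in fs.
  have last_s : last e0 s = nth e0 (e0 :: s) (size s) by rewrite (last_nth e0).
  rewrite last_s in mla.
  have [|fx cf] := fan_shifted ps u0 (leqnn _) Ef fl mxa.1 mla _ fa fs.
    by move=> k ks; have [Ek kx] := FE k.+1 ks; exact: mxa.2.
  exact: (mxa.2 f Ef fx cf).
- by move=> i is' _; exact: adj_fan.
- by move=> i si; rewrite ltnS => is'; lia.
- by rewrite ltnn.
- by rewrite ltnn.
Qed.

(** The path leaves [y] with the colour [al]. As [x] is not in its component, it contains no fan
    edge. The last hypothesis keeps it away from the outer ends that receive [be] when the fan is
    shifted; before its last edge no fan edge receives [al], which is missing at [x]. *)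
Lemma fan_alternating s al be : path (brel (fan_step x)) e0 s ->
    uniq (e0 :: s) -> let y := other (last e0 s) x in
    missing y be -> missing x al -> al <> be -> ~ linked (alt_link al be) y x ->
    (forall k, k < size s -> c (nth e0 (e0 :: s) k.+1) = be ->
       ~ linked (alt_link al be) y (other (nth e0 (e0 :: s) k) x)) ->
  exists es j al be, shift_chain L e0 es j al be.
Proof.
move=> ps u y yb xa ab nyx nyk; have [FE FK Fm] := fan_path ps.
have sD := fan_size ps u.
have [aK bK] : al < K /\ be < K by case: xa; case: yb.
pose vx := alt_vertex al be e0 y; pose ed := alt_edge al be e0 y.
(* The path stops at the first vertex that misses the next colour, and after [L] edges at the
   latest: [find] returns [L] when there is no such vertex. *)
pose l := find (fun i => `[< missing (vx i) (alt_color al be i) >]) (iota 0 L).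
have lL : l <= L by rewrite -[leqRHS](size_iota 0) find_size.
have lP i : i < l -> ~ missing (vx i) (alt_color al be i).
  move=> il; have /negbT := before_find 0 il.
  by rewrite nth_iota ?(leq_trans il)// add0n => /asboolPn.
have l_end : l < L -> missing (vx l) (alt_color al be l).
  move=> lltL.
  have hs : has (fun i => `[< missing (vx i) (alt_color al be i) >]) (iota 0 L).
    by rewrite has_find size_iota.
  by have := nth_find 0 hs; rewrite -/l nth_iota// add0n => /asboolP.
pose n := size s; pose es := e0 :: s ++ mkseq ed l.
have size_es : size es = (n + l).+1 by rewrite /= size_cat size_mkseq.
have nthF i : i <= n -> nth e0 es i = nth e0 (e0 :: s) i.
  by move=> is'; rewrite /es -cat_cons nth_cat /= ltnS is'.
have nthQ i : i < l -> nth e0 es (n.+1 + i) = ed i.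
  by move=> il; rewrite /es -cat_cons nth_cat /= ltnNge addSn ltnS leq_addr /=
    subSS addnC addnK nth_mkseq.
have edP i : i < l -> [/\ E (ed i), inc (ed i) (vx i), inc (ed i) (vx i.+1) &
    c (ed i) = alt_color al be i].
  exact: (@alt_edgeP al be aK bK e0 y l lP i).
have edL i v : i < l -> inc (ed i) v -> linked (alt_link al be) y v.
  exact: (@alt_edge_linked al be aK bK e0 y l lP).
have Fed k i : k <= n -> i < l -> nth e0 (e0 :: s) k <> ed i.
  by move=> kn il e; apply: nyx; apply: (edL i); rewrite // -e; have [] := FE k kn.
have ues : uniq es.
  rewrite /es -cat_cons cat_uniq u /=; apply/andP; split.
    apply/hasPn => _ /mapP[i + ->]; rewrite mem_iota add0n /= => il.
    apply/negP => /(nthP e0)[k kn e]; exact: (Fed k i).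
  rewrite map_inj_in_uniq ?iota_uniq// => i k.
  rewrite !mem_iota !add0n /= => il kl e; apply: contrapT => /eqP.
  by rewrite neq_ltn => /orP[ik|ki];
    [apply: (alt_edge_inj aK bK ab yb lP ik kl)
    |apply: (alt_edge_inj aK bK ab yb lP ki il)].
have last_s : last e0 s = nth e0 (e0 :: s) n by rewrite (last_nth e0).
have yE : y = other (nth e0 (e0 :: s) n) x by rewrite -last_s.
have edge_inj i f v : i < l -> E f -> inc f v -> inc (ed i) v ->
    c f = alt_color al be i -> f = ed i.
  exact: (@alt_edge_color_inj al be aK bK e0 y l lP).
have Fcol k : k < n -> c (nth e0 (e0 :: s) k.+1) <> al.
  by move=> kn; have [Ek kx] := FE k.+1 kn; exact: xa.2.
(* With the hole on the last fan edge, [al] can be met only at [y]: it is missing at [x] and is not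
   among the shifted fan colours. *)
have hole_fan f : E f -> adj f (nth e0 es n) -> f <> nth e0 es n ->
    shifted es n f = al -> inc f y /\ c f = al.
  move=> Ef [w [fw nw]] fn.
  have [|[k kn [-> ->]]|[_ ->]] := shiftedP e0 f ues (i := n).
  - by rewrite size_es ltnS leq_addr.
  - by rewrite nthF// => /(Fcol _ kn).
  move=> fal; split=> //; have [En nx] := FE n (leqnn _).
  rewrite nthF// in nw; case: (inc_eq nx nw) => wE; last by rewrite yE -wE.
  by case: (xa.2 f Ef) => //; rewrite -wE.
(* With the hole on the [i]-th path edge, the next colour can be met only at the far end: at the
   near end the edge that had it, if any, is the previous path edge, already recoloured. A
   recoloured fan edge showing it would touch the component of [y] against the hypotheses, or give
   an edge of colour [be] at [y]. *)
have hole_path i f : i < l -> E f -> adj f (ed i) -> f <> ed i ->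
    shifted es (n.+1 + i) f = alt_color al be i.+1 ->
    inc f (vx i.+1) /\ c f = alt_color al be i.+1.
  move=> il Ef [w [fw iw]] fi; have [Ei ia ib ci] := edP i il.
  have [|[k ki [fk ->]]|[fk ->]] := shiftedP e0 f ues (i := n.+1 + i).
  - by rewrite size_es addSn ltnS ltn_add2l.
  - have [kn|] := ltnP k n.
      rewrite nthF// => ck; have [Ek kx] := FE k (ltnW kn); exfalso.
      have {}ck : c (nth e0 (e0 :: s) k.+1) = be.
        by have := Fcol k kn; rewrite ck; case: (alt_colorP al be i.+1) => ->.
      have wL : linked (alt_link al be) y w by exact: edL il iw.
      rewrite fk nthF ?(ltnW kn)// in fw.
      case: (inc_eq kx fw) => wE; first by apply: nyx; rewrite -wE.
      by apply: (nyk k kn ck); rewrite -wE.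
    rewrite leq_eqVlt => /orP[/eqP nk|nk].
      subst k; rewrite -[n.+1]addn0 nthQ ?(leq_ltn_trans _ il)//.
      have [E0 _ _ c0] := edP 0 (leq_ltn_trans (leq0n _) il).
      rewrite c0 => /(alt_color_inj ab) oi; exfalso.
      have [En nx] := FE n (leqnn _).
      rewrite fk nthF// in fw; case: (inc_eq nx fw) => wE.
        by apply: nyx; rewrite -wE; exact: edL il iw.
      case: (yb) => _ yb'; apply: (yb' _ Ei); first by rewrite yE -wE.
      rewrite ci; by rewrite /alt_color; move: oi => /= /esym/negbFE ->.
    have kE : k = n.+1 + (k - n.+1) by rewrite subnKC.
    have ki' : k - n.+1 < i by move: ki; rewrite {1}kE ltn_add2l.
    rewrite fk kE -addnS !nthQ ?(leq_trans ki' (ltnW il))//; last first.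
      exact: leq_ltn_trans ki' il.
    have [Ek _ _ ck] := edP _ (leq_ltn_trans ki' il).
    rewrite ck => /(alt_color_inj ab) /= /(congr1 negb); rewrite !negbK => ok.
    exfalso; apply: fi; apply: (edge_inj i f w) => //.
    rewrite fk kE nthQ ?(leq_trans ki' (ltnW il))//.
    have [_ _ _ ->] := edP _ (ltn_trans ki' il).
    exact: alt_color_odd.
  move=> cf; split=> //; case: (inc_eq ia iw) => wE; last by rewrite /vx /= -wE.
  case: i il Ei ia ib ci iw fi fk cf wE => [|i] il Ei ia ib ci iw fi fk cf wE.
    by case: (yb) => _ /(_ _ Ef); rewrite -[y]/(vx 0) -wE => /(_ fw).
  have [Ei' _ ib' ci'] := edP i (ltnW il).
  case: (fk (n.+1 + i)); first by rewrite addnS.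
  rewrite nthQ ?(ltnW il)//; apply: (edge_inj i f w) => //; rewrite ?(ltnW il)//.
    by rewrite wE.
  by rewrite cf; apply: alt_color_odd; rewrite /= negbK.
exists es, n, al, be; split=> //.
- by rewrite size_es /= -addSn leq_add.
- by rewrite size_es ltnS leq_addr.
- by split; exact: ltnW.
- move=> i; rewrite size_es ltnS => iln; have [il|li] := leqP i n.
    by rewrite nthF//; have [] := FE i il.
  have iE : i = n.+1 + (i - n.+1) by rewrite subnKC.
  have il : i - n.+1 < l by lia.
  by rewrite iE nthQ//; have [] := edP _ il.
- move=> i; rewrite size_es ltnS => iln; have [il|] := ltnP i n.
    rewrite !nthF// 1?ltnW//; exists x.
    by split; [have [] := FE i (ltnW il) | have [] := FE i.+1 il].
  rewrite leq_eqVlt => /orP[/eqP ni|ni].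
    rewrite -ni in iln *; have l0 : 0 < l by lia.
    rewrite nthF// -[n.+1]addn0 nthQ//; exists y; split.
      by rewrite yE; apply: inc_other; have [] := FE n (leqnn _).
    by have [_ ia _ _] := edP 0 l0.
  have iE : i = n.+1 + (i - n.+1) by rewrite subnKC.
  have il : (i - n.+1).+1 < l by lia.
  rewrite iE -addnS !nthQ ?(ltnW il)//; exists (vx (i - n.+1).+1); split.
    by have [] := edP _ (ltnW il).
  by have [] := edP _ il.
- move=> i; rewrite size_es ltnS => iln; have [il|li] := ltnP i n.
    by rewrite nthF//; exact: FK.
  have iE : i.+1 = n.+1 + (i - n) by rewrite addSn subnKC.
  have il : i - n < l by lia.
  by rewrite iE nthQ//; have [_ _ _ ->] := edP _ il; exact: alt_color_ltK.
- move=> i f; rewrite size_es ltnS => iln Ef; have [il|] := ltnP i n.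
    rewrite !nthF// 1?ltnW// => fa fi fi1 fs.
    have [|fx cf] := fan_shifted ps ues (ltnW il) Ef fi (FK _ il) (Fm _ il) _ fa fs.
      move=> k ki ek; have ks := ltn_trans ki il.
      have /eqP := color_inj (FE _ ks).1 (FE _ il).1 (FE _ ks).2 (FE _ il).2
        (FK k ks) ek.
      by rewrite nth_uniq//= ?ltnS// eqSS => /eqP e; rewrite e ltnn in ki.
    apply: fi1; have [Ei ix] := FE _ il.
    by apply: (color_inj Ef Ei fx ix); rewrite cf ?FK.
  rewrite leq_eqVlt => /orP[/eqP ni|ni].
    rewrite -ni in iln *; have l0 : 0 < l by lia.
    have [E0 e0y _ c00] := edP 0 l0.
    rewrite -[n.+1]addn0 nthQ// c00 => fa fi fi1 fs.
    have [fy cf] := hole_fan f Ef fa fi fs.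
    by apply: fi1; apply: (edge_inj 0 f y).
  have iE : i = n.+1 + (i - n.+1) by rewrite subnKC.
  have il : (i - n.+1).+1 < l by lia.
  have [Ei ia _ ci] := edP _ il.
  rewrite iE -addnS !nthQ ?(ltnW il)// ci => fa fi fi1 fs.
  have [fv cf] := hole_path _ f (ltnW il) Ef fa fi fs.
  by apply: fi1; apply: (edge_inj _ f _ il Ef fv).
- rewrite size_es ltnS /=; have [->|lltL] := eqVneq l L; first by left; rewrite leq_addl.
  have {}lltL : l < L by rewrite ltn_neqAle lltL.
  have ml := l_end lltL; right; exists (alt_color al be l); first exact: alt_color_ltK.
  move=> f Ef; case: (posnP l) ml => [->|l0] ml.
    rewrite addn0 => fa fn fs; have [fy cf] := hole_fan f Ef fa fn fs.
    exact: ml.2 cf.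
  have lE : n + l = n.+1 + l.-1 by lia.
  have ll : l.-1 < l by rewrite prednK.
  rewrite lE nthQ// => fa fi; have := hole_path _ f ll Ef fa fi.
  rewrite prednK// => hp /hp[fv cf]; exact: ml.2 cf.
- by move=> i il _; rewrite nthF//; exact: adj_fan.
- move=> i ni; rewrite size_es ltnS => iln.
  have iE : i = n.+1 + (i - n.+1) by rewrite subnKC.
  have il : i - n.+1 < l by lia.
  by rewrite {1}iE nthQ//; have [_ _ _ ->] := edP _ il.
(* The first path edge is pendant among the edges of the two colours: as [be] is missing at [y], an
   adjacent edge of colour [be] meets it at its far end. *)
rewrite size_es ltnS -{1}[n]addn0 ltn_add2l => l0 f f' Ef Ef'.
move=> [w [fw iw]] [w' [fw' iw']] cf cf'.
rewrite -[n.+1]addn0 nthQ// in iw iw'.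
have [E0 ia ib _] := edP 0 l0.
have wE g v : E g -> inc g v -> inc (ed 0) v -> c g = be -> v = vx 1.
  move=> Eg gv iv cg; case: (inc_eq ia iv) => // vE.
  by case: (yb) => _ /(_ g Eg); rewrite -[y]/(vx 0) -vE => /(_ gv).
have fv := fw; rewrite (wE f w Ef fw iw cf) in fv.
have fv' := fw'; rewrite (wE f' w' Ef' fw' iw' cf') in fv'.
by apply: (color_inj Ef Ef' fv fv'); rewrite cf ?cf'.
Qed.

(** If the outer end of a reachable fan edge misses a colour missing at [x], a fan suffices.
    Otherwise two outer ends miss a common colour [be]; with [al] missing at [x], all three vertices
    are pendant for the colours [al] and [be]. A component has at most two pendant vertices, so one
    of the outer ends is not linked to [x]. *)
Lemma vizing_shift_chain : exists es j al be, shift_chain L e0 es j al be.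
Proof.
have fanE f : linked (fan_step x) e0 f ->
    exists s, [/\ path (brel (fan_step x)) e0 s, uniq (e0 :: s) & last e0 s = f].
  by move=> [s + <-] => /shortenP[t pt ut _]; exists t.
have [[f [a [lf ma mx]]]|H] := pselect (exists f a, [/\ linked (fan_step x) e0 f,
    missing (other f x) a & missing x a]).
  have [s [ps us sf]] := fanE f lf.
  by apply: (fan_terminal ps us _ mx); rewrite sf.
have {}H f a : linked (fan_step x) e0 f -> missing (other f x) a -> ~ missing x a.
  by move=> lf ma mx; apply: H; exists f, a.
have [f [f' [be [lf lf' ff' fb fb']]]] := fan_common_color Ee0 e0x ce0 H.
have [al xa] := missing_ex Ee0 x.
have albe : al <> be by move=> e; rewrite e in xa; exact: H lf fb xa.
have [aK bK] : al < K /\ be < K by case: xa; case: fb.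
have pend v : missing v al \/ missing v be -> pendant (alt_link al be) v.
  exact: missing_pendant.
have otx g : linked (fan_step x) e0 g -> other g x <> x.
  by move=> /(linked_fan Ee0 e0x)[Eg gx]; exact: other_neq (loopless Eg) gx.
have three y y' : missing y be -> missing y' be -> y <> x -> y' <> x ->
    linked (alt_link al be) y x -> linked (alt_link al be) y' x -> y = y'.
  move=> yb y'b yx y'x ly ly'; have sym := @alt_link_sym al be.
  apply: (pendant_linked_uniq sym (alt_link_deg2 aK bK) (a := x)).
  - by apply: pend; left.
  - by apply: pend; right.
  - by apply: pend; right.
  - by move=> /esym.
  - by move=> /esym.
  - exact: linked_sym.
  - exact: linked_sym.
wlog nl : f f' lf lf' ff' fb fb' / ~ linked (alt_link al be) (other f x) x.
  move=> W; have [l1|] := pselect (linked (alt_link al be) (other f x) x); last first.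
    exact: (W f f').
  apply: (W f' f) => //; first by move=> /esym.
  by move=> l2; apply: ff'; apply: three => //; exact: otx.
have [s [ps us sf]] := fanE f lf; rewrite -{}sf in fb nl.
have [FE FK Fm] := fan_path ps.
have [[k [ks ck lk]]|nk] := pselect (exists k, [/\ k < size s,
    c (nth e0 (e0 :: s) k.+1) = be &
    linked (alt_link al be) (other (last e0 s) x) (other (nth e0 (e0 :: s) k) x)]);
    last first.
  apply: (fan_alternating ps us fb xa albe nl) => k ks ck lk.
  by apply: nk; exists k.
(* If the shift gives [be] to a fan edge whose outer end lies in the component of the last outer
   end, the fan is cut at that edge. Its outer end also misses [be] and is still not linked to [x];
   since [be] occurs only once at [x], no earlier fan edge receives it. *)
pose t := take k s.
have ut : uniq (e0 :: t).
  by move: us; rewrite -(cat_take_drop k s) -cat_cons cat_uniq => /andP[].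
have pt : path (brel (fan_step x)) e0 t.
  by move: ps; rewrite -{1}(cat_take_drop k s) cat_path => /andP[].
have st : size t = k by rewrite size_take ks.
have nt i : i <= k -> nth e0 (e0 :: t) i = nth e0 (e0 :: s) i.
  by case: i => // i ik; rewrite /= nth_take.
have lt : last e0 t = nth e0 (e0 :: s) k by rewrite (last_nth e0) st nt.
have tb : missing (other (last e0 t) x) be by rewrite lt -ck; exact: Fm.
apply: (fan_alternating pt ut tb xa albe).
  rewrite lt => l2; apply: nl; exact: linked_trans lk l2.
move=> i; rewrite st => ik; rewrite nt// => ci _.
have is' := ltn_trans ik ks.
have /eqP := color_inj (FE _ is').1 (FE _ ks).1 (FE _ is').2 (FE _ ks).2 (FK i is')
  (etrans ci (esym ck)).
by rewrite nth_uniq//= ?ltnS// eqSS => /eqP e; rewrite e ltnn in ik.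
Qed.
End Chain.

(** * Bounding the holes whose chains pass through an edge *)

Section Trace.

Definition color_link al be z z' :=
  [/\ E z, E z', adj z z', z <> z' &
    c z = al /\ c z' = be \/ c z = be /\ c z' = al].

(* Satisfied by every edge [f] of a [shift_chain] issued from [e0]; the pendant
   edge [h] is the first edge of its alternating path.  The length of the chain
   is not involved, so only boundedly many [e0] are traced by [f]. *)
Definition traced f e0 := adj f e0 \/ exists al be h g,
  [/\ al < K, be < K & al <> be] /\
  [/\ E h, c h = al,
      forall z z', E z -> E z' -> adj z h -> adj z' h -> c z = be -> c z' = be ->
        z = z',
      linked (color_link al be) f h & [/\ E g, adj h g & adj g e0]].

Lemma small_adj z : small (Delta + Delta) [set f | E f /\ adj z f].
Proof.
have [s [sD sE]] := degE (ea z); have [t [tD tE]] := degE (eb z).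
exists (s ++ t); rewrite size_cat leq_add//; split=> // f [Ef [v [[<-|<-] fv]]].
  by rewrite mem_cat sE.
by rewrite mem_cat tE ?orbT.
Qed.

Lemma color_link_deg2 al be : al < K -> be < K -> al <> be ->
  max_degree2 (color_link al be).
Proof.
move=> aK bK ab z w1 w2 w3 [Ez E1 [v1 [z1 a1]] n1 c1] [_ E2 [v2 [z2 a2]] n2 c2].
move=> [_ E3 [v3 [z3 a3]] n3 c3] n12 n13.
have [e12 e13] : c w1 = c w2 /\ c w1 = c w3.
  by case: c1 c2 c3 => -[-> ->] [] [e ->] [] [e' ->]; split=> //;
    (case: ab; congruence).
have lt1 : c w1 < K by case: c1 => -[_ ->].
have v12 : v2 = other z v1.
  case: (inc_eq z1 z2) => // e; rewrite e in a2.
  by case: n12; exact: color_inj E1 E2 a1 a2 lt1 e12.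
have v13 : v3 = other z v1.
  case: (inc_eq z1 z3) => // e; rewrite e in a3.
  by case: n13; exact: color_inj E1 E3 a1 a3 lt1 e13.
rewrite v12 in a2; rewrite v13 in a3.
by apply: (color_inj E2 E3 a2 a3); rewrite -e12.
Qed.

(** All such [h] lie in the component of [f], and a component of a graph of degree at most two has
    at most two pendant points. *)
Lemma small_color_ends al be f : al < K -> be < K -> al <> be ->
  small 2 [set h | pendant (color_link al be) h /\ linked (color_link al be) f h].
Proof.
move=> aK bK ab; set S := [set h | _].
have sym z z' : color_link al be z z' -> color_link al be z' z.
  move=> [? ? /adj_sym ? zz' cc]; split=> //; first by move=> /esym.
  by case: cc => -[? ?]; [right | left].
have [[h1 S1]|n1] := pselect (exists h, S h); last first.
  by exists [::]; split=> // h Sh; case: n1; exists h.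
have [[h2 [S2 n12]]|n2] := pselect (exists h, S h /\ h1 <> h); last first.
  exists [:: h1]; split=> // h Sh; rewrite inE; apply/eqP; apply: contrapT => hh1.
  by apply: n2; exists h; split=> // /esym.
exists [:: h1; h2]; split=> // h3 S3; rewrite !inE.
apply/orP; have [->|/eqP n13] := eqVneq h3 h1; [by left | right].
case: S1 S2 S3 => [p1 l1] [p2 l2] [p3 l3].
apply/eqP/esym; apply: (pendant_linked_uniq sym (color_link_deg2 aK bK ab) p1 p2 p3 n12).
- by move=> /esym.
- exact: linked_trans (linked_sym sym l1) l2.
- exact: linked_trans (linked_sym sym l1) l3.
Qed.

(** The first summand counts the holes adjacent to a fan edge [f]. For a path edge there are [K]
    choices for each colour, two ends [h] of its component, and [Delta + Delta] choices for each
    step from [h] through [g] to the hole. *)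
Definition trace_size := (Delta + Delta) +
  K * (K * (2 * ((Delta + Delta) * (Delta + Delta)))).

Lemma small_traced f : small trace_size [set e | E e /\ traced f e].
Proof.
have sK : small K [set a | a < K].
  by exists (iota 0 K); rewrite size_iota; split=> // a; rewrite mem_iota.
have sAB al be : al < K -> be < K ->
    small (2 * ((Delta + Delta) * (Delta + Delta))) [set e | exists h,
      (al <> be /\ pendant (color_link al be) h /\ linked (color_link al be) f h) /\
      exists g, [set g | E g /\ adj h g] g /\ [set e | E e /\ adj g e] e].
  move=> aK bK; apply: small_bind => [|h _].
    have [e|ab] := pselect (al = be); first by exists [::]; split=> // h [].
    by apply: small_sub (small_color_ends f aK bK ab) => h [].
  by apply: small_bind => [|g _]; exact: small_adj.
have sN := small_bind sK (fun al aK => small_bind sK (fun be bK => sAB al be aK bK)).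
apply: small_sub (small_union (small_adj f) sN) => e [Ee [fe|]].
  by left.
move=> [al [be [h [g [[aK bK ab] [Eh ch hs lh [Eg hg ge]]]]]]]; right.
exists al; split=> //; exists be; split=> //; exists h; split; last by exists g.
split=> //; split=> // z z' [_ Ez hz _ cz] [_ Ez' hz' _ cz'].
by apply: hs => //; [exact: adj_sym|exact: adj_sym|move: cz|move: cz']; rewrite ch;
  move=> [] [].
Qed.

End Trace.

End Multigraph.

(** * Recolouring along labelled chains *)

Lemma measurable_imp d (T : measurableType d) (P : Prop) (S : set T) :
  (P -> measurable S) -> measurable [set z | P -> S z].
Proof.
move=> mS; have [p|np] := pselect P.
  have -> : [set z | P -> S z] = S by apply/seteqP; split=> z /=; [apply | move=> Sz _].
  exact: mS.
have -> : [set z | P -> S z] = setT by apply/seteqP; split=> z //=.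
exact: measurableT.
Qed.

Section LabelledGraph.
Context d (Z : measurableType d) (V : choiceType) (ea eb : Z -> V).
Context (Delta mu : nat) (E : set Z).
Let adj := adj ea eb.
Let K := (Delta + mu)%N.

(* A walk of length [n] exactly; [adj] being reflexive, this is distance [<= n]. *)
Fixpoint near n z z' := if n is m.+1 then
  exists2 u, [/\ E z, E u & adj z u] & near m u z' else z = z' /\ E z'.

Lemma near_edge n z z' : near n z z' -> E z /\ E z'.
Proof.
by elim: n z => [|n IH] z /=; [case=> -> | move=> [u [Ez _ _] /IH[]]].
Qed.

Lemma near_cat m n z u w : near m z u -> near n u w -> near (m + n) z w.
Proof.
elim: m z => [|m IH] z /=; first by case=> ->.
by move=> [v zv vu] uw; exists v => //; exact: IH.
Qed.

Lemma near1 z u : E z -> E u -> adj z u -> near 1 z u.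
Proof. by move=> Ez Eu zu; exists u. Qed.

Lemma near_sym n z u : near n z u -> near n u z.
Proof.
elim: n z => [|n IH] z; first by case=> ->.
move=> [v [Ez Ev /adj_sym vz] /IH uv]; rewrite -addn1; apply: near_cat uv _.
exact: near1.
Qed.

Lemma near_le m n z u : m <= n -> near m z u -> near n z u.
Proof.
move=> /subnK <-; elim: (n - m) => // k IH /[dup] /IH nzu /near_edge[Ez _].
by rewrite addSn; exists z => //; split=> //; exact: adj_refl.
Qed.

(** Measurability arguments on the graph go through this operator: [mN] is the only projection
    property that they use. *)
Definition nbhd (D : set Z) : set Z :=
  [set z | E z /\ exists z', [/\ E z', D z' & adj z z']].

Context (mE : measurable E).
Context (mN : forall D, measurable D -> measurable (nbhd D)).
Context (r : nat) (q : Z -> nat).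
Context (mq : forall n, measurable (E `&` q @^-1` [set n])).
Context (q_inj : forall z z', near r z z' -> q z = q z' -> z = z').

Lemma label_inj m z u v : near m z u -> near m z v -> m + m <= r -> q u = q v -> u = v.
Proof.
by move=> /near_sym uz zv mr; apply: q_inj; exact: near_le mr (near_cat uz zv).
Qed.

Definition borel_coloring (c : Z -> nat) := [/\ forall a, measurable (E `&` c @^-1` [set a]),
  forall z, E z -> c z <= K & proper_on ea eb K E c].

Definition override (c : Z -> nat) (S : set Z) a z := if `[< S z >] then a else c z.

Lemma overrideT c (S : set Z) a z : S z -> override c S a z = a.
Proof. by move=> Sz; rewrite /override asboolT. Qed.

Lemma overrideF c (S : set Z) a z : ~ S z -> override c S a z = c z.
Proof. by move=> Sz; rewrite /override asboolF. Qed.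

Lemma measurable_override c (S : set Z) a : measurable S ->
  (forall b, measurable (E `&` c @^-1` [set b])) ->
  forall b, measurable (E `&` override c S a @^-1` [set b]).
Proof.
move=> mS mc b.
rewrite [X in measurable X](_ : _ = ((E `&` S) `&` [set z | a = b]) `|`
    ((E `&` c @^-1` [set b]) `\` S)).
  apply: measurableU; last exact: measurableD.
  apply: measurableI; first exact: measurableI.
  have [->|ab] := pselect (a = b).
    by rewrite [X in measurable X](_ : _ = setT)//; apply/seteqP; split=> z //=.
  by rewrite [X in measurable X](_ : _ = set0)//; apply/seteqP; split=> z //=.
apply/seteqP; split=> z /=.
  move=> [Ez]; have [Sz|Sz] := pselect (S z).
    by rewrite (overrideT _ _ Sz); left.
  by rewrite (overrideF _ _ Sz); right.
by move=> [[[Ez Sz] <-]|[[Ez cz] Sz]]; rewrite ?(overrideT _ _ Sz) ?(overrideF _ _ Sz).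
Qed.

Section Coloring.
Context (c : Z -> nat) (c_good : borel_coloring c).

(** Labels and colours take countably many values, so any condition on the pair is a countable union
    of measurable pieces. *)
Lemma measurable_label (F : nat -> nat -> Prop) :
  measurable [set z | E z /\ F (q z) (c z)].
Proof.
have [mc _ _] := c_good.
rewrite [X in measurable X](_ : _ = \bigcup_n \bigcup_a
    ((E `&` q @^-1` [set n]) `&` ((E `&` c @^-1` [set a]) `&` [set _ | F n a]))).
  apply: bigcupT_measurable => n; apply: bigcupT_measurable => a.
  apply: measurableI => //; apply: measurableI => //.
  have [f|f] := pselect (F n a).
    by rewrite [X in measurable X](_ : _ = setT)//; apply/seteqP; split=> z //=.
  by rewrite [X in measurable X](_ : _ = set0)//; apply/seteqP; split=> z //=.
apply/seteqP; split=> z /=.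
  by move=> [Ez f]; exists (q z) => //; exists (c z).
by move=> [n _ [a _ [[Ez <-] [[_ <-] f]]]].
Qed.

Lemma measurable_nbhd_label (F : nat -> nat -> Prop) :
  measurable (nbhd [set z | E z /\ F (q z) (c z)]).
Proof. exact/mN/measurable_label. Qed.

(** * Simultaneous chains of one type *)

Section Chain.
Context (lab col : nat -> nat) (l j al be : nat) (o : option nat).

(** The analogue of [shifted] read from labels: an edge is recognised as the [k]-th edge of a chain
    by its label alone, which is justified near a chain because labels are distinct in balls of
    radius [r]. *)
Definition shift_color i n a :=
  let k := index n (map lab (iota 0 i)) in if k < i then col k.+1 else a.

(** The edges where giving the colour [g] at stage [i] fails: a neighbour, other than the current
    and the next edge of the chain, shows [g] after [i] moves. *)
Definition conflict i g := nbhd [set f | E f /\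
  (q f <> lab i /\ (i < l -> q f <> lab i.+1) /\ shift_color i (q f) (c f) = g)].

(* The possible [i]-th edges of a chain with labels [lab] and colours [col]: the
   shift is allowed at stage [i] (and, if [o = Some g], the last hole can be
   coloured with [g]); the last two clauses provide [traced]. *)
Definition link i : set Z := [set z | E z /\ (q z = lab i /\ c z = col i)] `&`
  [set z | i < l -> (~` conflict i (col i.+1)) z] `&`
  [set z | i = l -> forall g, o = Some g -> (~` conflict i g) z] `&`
  [set z | i <= j -> nbhd [set f | E f /\ q f = lab 0] z] `&`
  [set z | i = j.+1 -> forall f f', E f -> E f' -> adj f z -> adj f' z ->
     c f = be -> c f' = be -> f = f'].

Hypothesis r2 : 2 <= r.

Lemma measurable_link i : measurable (link i).
Proof.
have mconf g : measurable (conflict i g).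
  exact: (measurable_nbhd_label (fun n a => n <> lab i /\
    (i < l -> n <> lab i.+1) /\ shift_color i n a = g)).
have ml : measurable [set z | E z /\ (q z = lab i /\ c z = col i)].
  exact: (measurable_label (fun n a => n = lab i /\ a = col i)).
rewrite /link; set A1 := [set z | i < l -> _]; set A2 := [set z | i = l -> _].
set A3 := [set z | i <= j -> _]; set A4 := [set z | i = j.+1 -> _].
have m1 : measurable A1 by apply: measurable_imp => _; exact: measurableC.
have m2 : measurable A2.
  apply: measurable_imp => _; case: o => [g|].
    rewrite [X in measurable X](_ : _ = ~` conflict i g); first exact: measurableC.
    by apply/seteqP; split=> z /= => [H|H g' [<-]//]; exact: H.
  by rewrite [X in measurable X](_ : _ = setT)//; apply/seteqP; split=> z //=.
have m3 : measurable A3.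
  apply: measurable_imp => _; apply: mN; exact: (measurable_label (fun n _ => n = lab 0)).
pose B n := nbhd [set f | E f /\ (q f = n /\ c f = be)].
have mB n : measurable (B n).
  exact: (measurable_nbhd_label (fun m a => m = n /\ a = be)).
have mE4 : measurable (E `&` A4).
  have [ij|ij] := pselect (i = j.+1); last first.
    rewrite [X in measurable X](_ : _ = E)//.
    by apply/seteqP; split=> z; [case | move=> Ez; split].
  (* Distinct neighbours of [z] have distinct labels, so uniqueness fails on a countable union over
     pairs of labels. *)
  rewrite [X in measurable X](_ : _ =
      E `\` \bigcup_n \bigcup_(m in [set m | m <> n]) (B n `&` B m)).
    apply: measurableD => //; apply: bigcupT_measurable => n.
    by apply: bigcup_measurable => m _; exact: measurableI.
  apply/seteqP; split=> z /=.
    move=> [Ez /(_ ij) H]; split=> // -[n _ [m /= mn]].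
    move=> [[_ [f [Ef [_ [qf cf]] zf]]] [_ [f' [Ef' [_ [qf' cf']] zf']]]].
    apply: mn; rewrite -qf -qf'; congr q.
    by apply: H => //; exact: adj_sym.
  move=> [Ez H]; split=> // _ f f' Ef Ef' /adj_sym fz /adj_sym fz' cf cf'.
  apply: (@label_inj 1 z) => //; [exact: near1|exact: near1|].
  apply: contrapT => qff; apply: H; exists (q f') => //; exists (q f) => //.
  by split; split=> //; [exists f' | exists f].
rewrite [X in measurable X](_ : _ = [set z | E z /\ (q z = lab i /\ c z = col i)] `&`
    A1 `&` A2 `&` A3 `&` (E `&` A4)).
  have m12 := measurableI _ _ (measurableI _ _ ml m1) m2.
  exact: measurableI (measurableI _ _ m12 m3) mE4.
apply/seteqP; split=> z; first by move=> [[[[[Ez qc] ?] ?] ?] ?].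
by move=> [[[[qc ?] ?] ?] [? ?]].
Qed.

(** The edges that qualify for stage [i] and from which [m] more stages can be completed, built
    backwards so that each stage costs one [nbhd]. *)
Fixpoint chain_dom_rec m i := if m is m'.+1 then
  link i `&` nbhd (chain_dom_rec m' i.+1) else link i.

Definition chain_dom i := chain_dom_rec (l - i) i.

Lemma chain_domE i : i < l -> chain_dom i = link i `&` nbhd (chain_dom i.+1).
Proof. by move=> il; rewrite /chain_dom -(subnSK il). Qed.

Lemma chain_dom_last : chain_dom l = link l.
Proof. by rewrite /chain_dom subnn. Qed.

Lemma chain_dom_link i : chain_dom i `<=` link i.
Proof. by rewrite /chain_dom; case: (l - i) => // m z []. Qed.

Lemma measurable_chain_dom i : measurable (chain_dom i).
Proof.
rewrite /chain_dom; move: (l - i) => m.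
elim: m i => [|m IH] i /=; first exact: measurable_link.
by apply: measurableI; [exact: measurable_link | exact/mN/IH].
Qed.

Section Images.
Context (S : set Z) (mS : measurable S) (S_dom : S `<=` chain_dom 0).

(** The [i]-th edges of the chains that start in [S]. Intersecting with [chain_dom] keeps partial
    chains extendable to the end. *)
Fixpoint chain_image i : set Z :=
  if i is i'.+1 then nbhd (chain_image i') `&` chain_dom i else S.

Lemma measurable_chain_image i : measurable (chain_image i).
Proof.
elim: i => //= i IH; apply: measurableI; first exact: mN.
exact: measurable_chain_dom.
Qed.

Lemma image_dom i : chain_image i `<=` chain_dom i.
Proof. by case: i => [|i] // z []. Qed.

Lemma image_link i : chain_image i `<=` link i.
Proof. by move=> z /image_dom /chain_dom_link. Qed.

Lemma image_edge i f : chain_image i f -> E f.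
Proof. by move=> /image_link[[[[[]]]]]. Qed.

Lemma image_lab i f : chain_image i f -> q f = lab i.
Proof. by move=> /image_link[[[[[_ []]]]]]. Qed.

Lemma image_col i f : chain_image i f -> c f = col i.
Proof. by move=> /image_link[[[[[_ []]]]]]. Qed.

Lemma image_next i f : i < l -> chain_image i f ->
  exists2 g, chain_image i.+1 g & adj f g.
Proof.
move=> il fi; have := image_dom fi; rewrite chain_domE// => -[_ [Ef [g [Eg dg fg]]]].
exists g => //; split=> //; split=> //; exists f; split=> //; exact: adj_sym.
Qed.

Lemma image_trace i f : chain_image i f -> exists z : nat -> Z,
  [/\ z i = f, forall k, k <= i -> chain_image k (z k) &
      forall k, k < i -> adj (z k) (z k.+1)].
Proof.
elim: i f => [|i IH] f fi.
  by exists (fun=> f); split=> // k; rewrite leqn0 => /eqP ->.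
have [[Ef [g [Eg gi fg]]] _] := fi; have [z [zi zk za]] := IH _ gi.
exists (fun k => if k == i.+1 then f else z k); split; first by rewrite eqxx.
  by move=> k; rewrite leq_eqVlt; case: eqP => [->//|_]; rewrite ltnS; exact: zk.
move=> k ki; rewrite (ltn_eqF ki) eqSS; move: ki; rewrite ltnS => ki.
case: eqP => [->|/eqP ki']; first by rewrite zi; exact: adj_sym.
by apply: za; rewrite ltn_neqAle ki'.
Qed.

Lemma image_back i k f : chain_image i f -> k <= i ->
  exists2 g, chain_image k g & near (i - k) g f.
Proof.
move=> /image_trace[z [<- zk za]] ki; exists (z k); first exact: zk.
have -> : z i = z (k + (i - k)) by rewrite subnKC.
have : k + (i - k) <= i by rewrite subnKC.
elim: (i - k) => [|m IH] km.
  by rewrite addn0; split=> //; exact: image_edge (zk _ ki).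
rewrite addnS -addn1; apply: near_cat (IH (ltnW _)) _; first by rewrite -addnS.
apply: near1; [apply: image_edge (zk (k + m) _)
  |apply: image_edge (zk (k + m).+1 _)|apply: za];
  by rewrite -?addnS // ltnW// -addnS.
Qed.


(** * Moving the holes of one type *)

Section Recolor.
Hypothesis r_ge : l.+2 <= r.
Hypothesis lab_inj : forall i k, i <= l -> k <= l -> lab i = lab k -> i = k.
Hypothesis col0 : col 0 = K.
Hypothesis col_lt : forall i, 0 < i -> i <= l -> col i < K.

Fixpoint recolor i : Z -> nat := if i is i'.+1 then
  override (override (recolor i') (chain_image i) K) (chain_image i') (col i) else c.

Lemma image_disj i k f : i <= l -> k <= l -> chain_image i f -> chain_image k f -> i = k.
Proof.
by move=> il kl /image_lab fi /image_lab fk; apply: lab_inj; rewrite -?fi -?fk.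
Qed.

Lemma recolorP i : i <= l ->
  [/\ forall k f, k < i -> chain_image k f -> recolor i f = col k.+1,
      forall f, chain_image i f -> recolor i f = K &
      forall f, (forall k, k <= i -> ~ chain_image k f) -> recolor i f = c f].
Proof.
elim: i => [|i IH] il.
  by split=> // f /image_col; rewrite col0.
have [IH1 IH2 IH3] := IH (ltnW il); split=> [k f|f fi|f fn].
- rewrite ltnS leq_eqVlt => /orP[/eqP -> fi|ki fk]; first by rewrite [LHS]overrideT.
  rewrite [LHS]overrideF; last first.
    move=> fi; have kl := leq_trans (ltnW ki) (ltnW il).
    by rewrite (image_disj kl (ltnW il) fk fi) ltnn in ki.
  rewrite overrideF; first exact: IH1.
  move=> fi; have kl := leq_trans (ltnW ki) (ltnW il).
  by rewrite (image_disj kl il fk fi) ltnNge leqnSn in ki.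
- rewrite [LHS]overrideF ?overrideT// => fi'.
  by have /eqP := image_disj il (ltnW il) fi fi'; rewrite eqn_leq ltnn.
- rewrite [LHS]overrideF ?overrideF; first by apply: IH3 => k ki; apply: fn; exact: leqW.
    exact: fn.
  exact: (fn i (leqnSn i)).
Qed.

(** A neighbour [g] labelled [lab k] with [k < i] is within distance [i - k + 1] of the [k]-th edge
    of a chain through [f], hence is that edge. So around [f] the simultaneous move looks like the
    move along a single chain. *)
Lemma recolor_shift i f g : i <= l -> chain_image i f -> E g -> adj f g -> f <> g ->
  q g <> lab i /\ recolor i g = shift_color i (q g) (c g).
Proof.
move=> il fi Eg fg nfg; have Ef := image_edge fi.
have qg : q g <> lab i.
  rewrite -(image_lab fi) => e; apply: nfg; apply: (@q_inj f g) => //.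
  by apply: near_le (near1 Ef Eg fg); exact: leq_trans r_ge.
split=> //; rewrite /shift_color; set k := index _ _.
have [RC1 RC2 RC3] := recolorP il.
have sz : size (map lab (iota 0 i)) = i by rewrite size_map size_iota.
case: ltnP => ki; last first.
  apply: RC3 => k'; rewrite leq_eqVlt => /orP[/eqP ->|ki'] gk.
    exact/qg/image_lab/gk.
  move: ki; rewrite leqNgt -[X in _ < X]sz index_mem => /negP; apply.
  by rewrite (image_lab gk) map_f// mem_iota.
have qgk : q g = lab k.
  have : q g \in map lab (iota 0 i) by rewrite -index_mem sz.
  by move=> /(nth_index 0); rewrite -/k (nth_map 0) ?size_iota// nth_iota.
have [z zk zf] := image_back fi (ltnW ki).
suff -> : g = z by exact: RC1 zk.
apply: q_inj; last by rewrite qgk (image_lab zk).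
apply/near_sym/(@near_le ((i - k) + 1)); last exact: near_cat zf (near1 Ef Eg fg).
by rewrite addn1 (leq_trans _ r_ge)// ltnS (leq_trans (leq_subr _ _))// ltnW.
Qed.

Lemma recolor_le i f : i <= l -> E f -> recolor i f <= K.
Proof.
have [_ cK _] := c_good.
elim: i => [|i IH] il Ef; first exact: cK.
rewrite /= {1}/override; case: ifP => _; first exact/ltnW/col_lt.
by rewrite /override; case: ifP => // _; exact: IH (ltnW il) Ef.
Qed.

(** Each move gives new colours only to the edges of the previous image, so only pairs containing
    one of them have to be checked; for these the [conflict] clause of [link] applies. *)
Lemma borel_coloring_recolor i : i <= l -> borel_coloring (recolor i).
Proof.
move=> il; split=> [|z Ez|]; last 2 first.
- exact: recolor_le.
- elim: i il => [|i IH] il; first by case: c_good.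
  have {}IH := IH (ltnW il).
  suff W f g : chain_image i f -> E f -> E g -> adj f g -> f <> g ->
      recolor i.+1 f = recolor i.+1 g -> K <= recolor i.+1 f.
    move=> f g Ef Eg fg nfg efg.
    have [fi|fi] := pselect (chain_image i f); first exact: W efg.
    have [gi|gi] := pselect (chain_image i g).
      rewrite efg; apply: (W g f) => //; first exact: adj_sym.
      by move=> /esym.
    have [fi1|fi1] := pselect (chain_image i.+1 f).
      by have [_ RC _] := recolorP il; rewrite (RC f fi1).
    have [gi1|gi1] := pselect (chain_image i.+1 g).
      by have [_ RC _] := recolorP il; rewrite efg (RC g gi1).
    move: efg; rewrite [LHS]overrideF// [LHS]overrideF//.
    rewrite [RHS]overrideF// [RHS]overrideF//.
    move=> efg; rewrite [recolor _ _]overrideF// [X in _ <= X]overrideF//.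
    exact: IH efg.
  move=> fi Ef Eg fg nfg efg; rewrite leqNgt; apply/negP => fK.
  have [qg rg] := recolor_shift (ltnW il) fi Eg fg nfg.
  have [h hi1 fh] := image_next il fi.
  have [RC1 RC2 RC3] := recolorP il.
  have fcol : recolor i.+1 f = col i.+1 by exact: RC1.
  have ngi : ~ chain_image i g by move=> /image_lab.
  have [gi1|gi1] := pselect (chain_image i.+1 g).
    by move: fK; rewrite efg (RC2 g gi1) ltnn.
  have := image_link fi => -[[[[_ nc] _] _] _]; apply: (nc il); split=> //.
  exists g; split=> //; split=> //; split=> //; split=> [_ qgi|]; last first.
    by rewrite -rg -fcol efg [RHS]overrideF// overrideF.
  (* A neighbour labelled [lab i.+1] is the next edge [h] of the chain, which has just become a
     hole. *)
  apply: gi1; suff -> : g = h by [].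
  apply: (label_inj (near1 Ef Eg fg) (near1 Ef (image_edge hi1) fh)) => //.
  by rewrite qgi (image_lab hi1).
elim: i il => [|i IH] il; first by case: c_good.
apply: measurable_override; first exact: measurable_chain_image.
apply: measurable_override; first exact: measurable_chain_image.
exact: IH (ltnW il).
Qed.

Lemma recolor_holes i : i <= l -> E `&` recolor i @^-1` [set K] `<=`
  ((E `&` c @^-1` [set K]) `\` S) `|` chain_image i.
Proof.
move=> il f [Ef /= fK]; have [RC1 RC2 RC3] := recolorP il.
have [fi|fi] := pselect (chain_image i f); [by right | left].
have nk k : k <= i -> ~ chain_image k f.
  rewrite leq_eqVlt => /orP[/eqP ->//|ki] fk.
  have := col_lt (ltn0Sn k) (leq_trans ki il).
  by rewrite -(RC1 k f ki fk) fK ltnn.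
by split; [split=> //=; rewrite -RC3 | exact: (nk 0)].
Qed.

Lemma borel_coloring_terminal g : o = Some g -> g < K ->
  borel_coloring (override (recolor l) (chain_image l) g).
Proof.
move=> og gK; have [RC1 RC2 RC3] := recolorP (leqnn l).
have [mrec rK rP] := borel_coloring_recolor (leqnn l); split=> [|z Ez|].
- by apply: measurable_override => //; exact: measurable_chain_image.
- by rewrite /override; case: ifP => // _; [exact: ltnW | exact: rK].
suff W f h : chain_image l f -> E f -> E h -> adj f h -> f <> h ->
    override (recolor l) (chain_image l) g f <> override (recolor l) (chain_image l) g h.
  move=> f h Ef Eh fh nfh efh.
  have [fi|fi] := pselect (chain_image l f); first by case: (W f h fi Ef Eh fh nfh).
  have [hi|hi] := pselect (chain_image l h).
    by case: (W h f hi Eh Ef (adj_sym fh) _ (esym efh)) => /esym.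
  by move: efh; rewrite !overrideF//; exact: rP.
move=> fi Ef Eh fh nfh; have [qh rh] := recolor_shift (leqnn l) fi Eh fh nfh.
rewrite overrideT// overrideF; last by move=> /image_lab.
rewrite rh => egh; have := image_link fi => -[[[_ nc] _] _].
apply: (nc erefl g og); split=> //; exists h; split=> //; split=> //; split=> //.
by rewrite ltnn.
Qed.

Lemma terminal_holes g : g < K ->
  E `&` override (recolor l) (chain_image l) g @^-1` [set K] `<=`
  (E `&` c @^-1` [set K]) `\` S.
Proof.
move=> gK f [Ef /=]; have [fi|fi] := pselect (chain_image l f).
  by rewrite overrideT// => gE; move: gK; rewrite gE ltnn.
rewrite overrideF// => fK.
by case: (@recolor_holes l (leqnn l) f (conj Ef fK)).
Qed.

Hypothesis alt : forall i, j < i -> i <= l -> col i = if odd (i - j.+1) then be else al.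
Hypothesis albe : j < l -> [/\ al < K, be < K & al <> be].

(** The chain is followed back from [f] to its hole; on the path part the alternating colours make
    it a [color_link] path to the pendant edge [z j.+1]. *)
Lemma image_traced i f : i <= l -> chain_image i f ->
  exists2 e, S e & traced ea eb Delta mu E c f e.
Proof.
move=> il fi; have [z [zi zk za]] := image_trace fi.
have zn k : k <= i -> near k (z 0) (z k).
  elim: k => [_|k IH ki]; first by split=> //; exact: image_edge (zk 0 _).
  have := near_cat (IH (ltnW ki)) (near1 (image_edge (zk k (ltnW ki)))
    (image_edge (zk k.+1 ki)) (za k ki)).
  by rewrite addn1.
have z0 k : k <= i -> k <= j -> adj (z k) (z 0).
  move=> ki kj.
  have [[_ /(_ kj)[Ek [g [Eg [_ qg] kg]]]] _] := image_link (zk k ki).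
  (* [link] only provides a neighbour labelled [lab 0]; labels being distinct nearby, it is the hole
     itself. *)
  suff -> : z 0 = g by [].
  apply: q_inj; last by rewrite qg (image_lab (zk 0 (leq0n _))).
  apply: near_le (near_cat (zn k ki) (near1 Ek Eg kg)).
  by rewrite addn1; apply: leq_trans r_ge; rewrite ltnS (leq_trans ki)// ltnW.
exists (z 0); first exact: (zk 0 (leq0n i)).
have [ij|ji] := leqP i j; first by left; rewrite -zi; exact: z0.
have jl := leq_trans ji il; have [aK bK ab] := albe jl.
have zc k : j < k -> k <= i -> c (z k) = if odd (k - j.+1) then be else al.
  by move=> jk ki; rewrite (image_col (zk k ki)) alt// (leq_trans ki).
have zE k : k <= i -> E (z k) by move=> /zk/image_edge.
right; exists al, be, (z j.+1), (z j); split=> //; split.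
- exact: zE.
- by rewrite zc// subnn.
- by have [_ /(_ erefl)] := image_link (zk _ ji).
- rewrite -zi; have : i <= i by []; rewrite -{1 3}(subnKC ji).
  elim: (i - j.+1) => [|m IH]; first by rewrite addn0 => _; exact: linked_refl.
  rewrite addnS => mi; apply: linked_trans (IH (ltnW mi)); apply: linked_step.
  have jm : j < j.+1 + m by rewrite addSn ltnS leq_addr.
  have cc : c (z (j.+1 + m)) = if odd m then be else al.
    by rewrite (zc _ jm (ltnW mi)) addKn.
  have cc1 : c (z (j.+1 + m).+1) = if odd m.+1 then be else al.
    by rewrite (zc _ (leqW jm) mi) -[X in odd (X - _)]addnS addKn.
  split; [exact: zE|exact: zE (ltnW mi)|exact/adj_sym/za| |].
    by move=> e; move: cc cc1; rewrite e => -> /=; case: odd => //= /esym.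
  by rewrite cc cc1 /=; case: odd; [left|right].
- split; [exact: zE (ltnW ji)|exact/adj_sym/za|exact: z0 (ltnW ji) _].
Qed.
End Recolor.

End Images.
End Chain.

(** [o = Some g] stands for a chain whose last edge can take the colour [g], and [o = None] for one
    with at least [L] moves. *)
Record chain_data L (lab col : nat -> nat) (l j al be : nat) (o : option nat) : Prop :=
  ChainData {
  cd_inj : forall i k, i <= l -> k <= l -> lab i = lab k -> i = k ;
  cd_col0 : col 0 = K ;
  cd_col : forall i, 0 < i -> i <= l -> col i < K ;
  cd_alt : forall i, j < i -> i <= l -> col i = if odd (i - j.+1) then be else al ;
  cd_albe : j < l -> [/\ al < K, be < K & al <> be] ;
  cd_long : o = None -> L <= l ;
  cd_end : forall g, o = Some g -> g < K ;
  cd_size : l < Delta + L }.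

Context (L : nat) (r_ge : (Delta + L) + (Delta + L) + 2 <= r).

(** * Every hole has a chain type *)

Section Existence.
Hypothesis loopless : forall z, E z -> ea z <> eb z.
Hypothesis degE : forall v, exists s : seq Z,
  size s <= Delta /\ forall z, E z -> inc ea eb z v -> z \in s.
Hypothesis multE : forall v w, v <> w -> exists s : seq Z,
  size s <= mu /\ forall z, E z -> inc ea eb z v -> inc ea eb z w -> z \in s.

(** [lab] and [col] are any functions that agree with the chain on its indices, so that the lemma
    applies to functions decoded from a finite type. *)
Lemma chain_data_ex e : E e -> c e = K -> exists es j al be o,
  [/\ size es <= Delta + L, (forall f, f \in es -> E f), j <= Delta + L,
      al <= K & be <= K] /\
  forall lab col, (forall i, i < size es ->
      lab i = q (nth e es i) /\ col i = c (nth e es i)) ->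
    chain_data L lab col (size es).-1 j al be o /\
    chain_dom lab col (size es).-1 j be o 0 e.
Proof.
move=> Ee ce; have [mc cK c_prop] := c_good.
have [es [j [al [be sc]]]] := vizing_shift_chain loopless degE multE c_prop L
  Ee (or_introl erefl) (eq_leq (esym ce)).
case: sc => ues /andP[es0 esL] jes [alK beK] e0 esE esA esC free last fan alt albe start.
pose l := (size es).-1.
have les : size es = l.+1 by rewrite prednK.
have [ot [oL og olast]] : exists ot, [/\ ot = None -> L <= l,
    forall g, ot = Some g -> g < K &
    forall g, ot = Some g -> forall f, E f -> adj f (nth e es l) -> f <> nth e es l ->
    shifted c es l f <> g].
  case: last => [Ll|[g gK H]]; last by exists (Some g); split=> // g' [<-].
  by exists None; split=> // _; rewrite -ltnS -les.
exists es, j, al, be, ot; split.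
  split=> //; last by rewrite (leq_trans (ltnW jes)).
  by move=> f /(nthP e)[i ies <-]; exact: esE.
move=> lab col H; rewrite -/l.
have labE i : i <= l -> lab i = q (nth e es i).
  by move=> il; have [|] := H i; rewrite ?les.
have colE i : i <= l -> col i = c (nth e es i).
  by move=> il; have [|] := H i; rewrite ?les.
have nearE i k : i <= k -> k <= l -> near (k - i) (nth e es i) (nth e es k).
  move=> ik; rewrite -{1 3}(subnKC ik); elim: (k - i) => [|m IH] kl.
    by rewrite addn0 in kl *; split=> //; apply: esE; rewrite les.
  rewrite -addn1; apply: near_cat (IH _) _; first by rewrite (leq_trans _ kl)// leq_add2l.
  rewrite addnA addn1; apply: near1; [apply: esE|apply: esE|apply: esA];
    rewrite les ltnS; move: kl; rewrite addnS//; exact: ltnW.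
have ll : l < Delta + L by rewrite -les.
have lr : l + l <= r.
  by rewrite (leq_trans _ r_ge)// (leq_trans _ (leq_addr _ _))// leq_add// ltnW.
have lab_inj i k : i <= l -> k <= l -> lab i = lab k -> i = k.
  move=> il kl; rewrite !labE// => qik.
  have n0 m : m <= l -> near l e (nth e es m).
    move=> ml; rewrite -[X in near _ X _]e0; apply: near_le (nearE 0 m (leq0n _) ml).
    by rewrite subn0.
  have /eqP := label_inj (n0 i il) (n0 k kl) lr qik.
  by rewrite nth_uniq ?les// => /eqP.
(* Labels determine the edges around the chain, so the label version of the shift agrees with the
   true one. *)
have sh i f : i <= l -> E f -> adj f (nth e es i) ->
    shift_color lab col i (q f) (c f) = shifted c es i f.
  move=> il Ef fi; rewrite /shift_color; set k := index _ _.
  have sz : size (map lab (iota 0 i)) = i by rewrite size_map size_iota.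
  have close k' : k' <= i -> q f = lab k' -> f = nth e es k'.
    move=> ki qf; apply: q_inj; last by rewrite qf labE// (leq_trans ki).
    have Ei : E (nth e es i) by apply: esE; rewrite les.
    apply/near_sym/(@near_le ((i - k') + 1)); last first.
      by apply: near_cat (nearE _ _ ki il) (near1 Ei Ef (adj_sym fi)).
    apply: leq_trans r_ge; lia.
  have ies : i < size es by rewrite les.
  case: ltnP => ki.
    have qfk : q f = lab k.
      have : q f \in map lab (iota 0 i) by rewrite -index_mem sz.
      by move=> /(nth_index 0); rewrite -/k (nth_map 0) ?size_iota// nth_iota.
    have fk := close k (ltnW ki) qfk.
    rewrite /shifted fk (index_uniq _ (ltn_trans ki ies) ues) ki.
    rewrite colE ?(leq_trans ki)//; congr c; apply: set_nth_default.
    exact: leq_ltn_trans ies.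
  have [|[k' k'i [fk _]]|[_ ->//]] := shiftedP c e f ues (i := i).
    by rewrite les.
  move: ki; rewrite leqNgt -[X in _ < X]sz index_mem => /negP; case.
  rewrite fk -labE; first by rewrite map_f// mem_iota.
  exact: leq_trans (ltnW k'i) il.
have linkE i : i <= l -> link lab col l j be ot i (nth e es i).
  move=> il; have Ei : E (nth e es i) by apply: esE; rewrite les.
  split; [split; [split; [split|]|]|].
  - by split=> //; rewrite labE// colE.
  - move=> ilt [_ [f [Ef [_ [qf [qf1 sf]]] fi]]].
    have i1 : i.+1 < size es by rewrite les.
    apply: (free i f i1 Ef (adj_sym fi)) => [fe|fe|].
    + by apply: qf; rewrite fe labE.
    + by apply: (qf1 ilt); rewrite fe labE.
    + by rewrite -sh//; [rewrite sf colE | exact: adj_sym].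
  - move=> ie g og' [_ [f [Ef [_ [qf [_ sf]]] fi]]]; rewrite {}ie in qf sf fi.
    apply: (olast g og' f Ef (adj_sym fi)) => [fe|].
      by apply: qf; rewrite fe labE.
    by rewrite -sh//; exact: adj_sym.
  - move=> ij; split=> //; exists e; split=> //; first by rewrite labE// e0.
    by apply: fan => //; rewrite les.
  - move=> ie f f' Ef Ef' fi fi' cf cf'; rewrite {}ie in il fi fi'.
    by apply: start fi fi' cf cf' => //; rewrite les.
split.
  split=> //.
  - by rewrite colE// e0.
  - by case=> // i _ il; rewrite colE//; apply: esC; rewrite les.
  - by move=> i ji il; rewrite colE//; apply: alt => //; rewrite les.
  - by move=> jl; apply: albe; rewrite les.
have domE m i : i + m = l -> chain_dom lab col l j be ot i (nth e es i).
  elim: m i => [|m IH] i.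
    by rewrite addn0 => ->; rewrite chain_dom_last; exact: linkE.
  rewrite addnS -addSn => im; have il : i < l by rewrite -im ltnS leq_addr.
  rewrite chain_domE//; split; first exact/linkE/ltnW.
  split; first by apply: esE; rewrite les ltnS ltnW.
  exists (nth e es i.+1); split; [by apply: esE; rewrite les|exact: IH|].
  by apply: esA; rewrite les.
by rewrite -[X in chain_dom _ _ _ _ _ _ _ X]e0; apply: (domE l).
Qed.

End Existence.

Section Moves.
Context (lab col : nat -> nat) (l j al be : nat) (o : option nat).
Hypothesis cd : chain_data L lab col l j al be o.
Context (S : set Z) (mS : measurable S) (S_dom : S `<=` chain_dom lab col l j be o 0).

Let img := chain_image lab col l j be o S.

Let r_l : l.+2 <= r.
Proof. by have := cd_size cd; lia. Qed.

Let r2 : 2 <= r. Proof. by lia. Qed.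

Lemma chain_move i : i <= l -> exists2 c', borel_coloring c' &
  E `&` c' @^-1` [set K] `<=` ((E `&` c @^-1` [set K]) `\` S) `|` img i.
Proof.
case: cd => inj c0 cK *; exists (recolor lab col l j be o S i).
  exact: borel_coloring_recolor.
exact: recolor_holes.
Qed.

Lemma chain_finish : o <> None -> exists2 c', borel_coloring c' &
  E `&` c' @^-1` [set K] `<=` (E `&` c @^-1` [set K]) `\` S.
Proof.
case: cd => inj c0 cK _ _ _ oK _; case: o oK S_dom => // g /(_ g erefl) gK S_dom' _.
exists (override (recolor lab col l j be (Some g) S l)
  (chain_image lab col l j be (Some g) S l) g).
  exact: borel_coloring_terminal.
exact: terminal_holes.
Qed.

Lemma chain_image_traced i f : i <= l -> img i f ->
  exists2 e, S e & traced ea eb Delta mu E c f e.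
Proof.
case: cd => inj c0 cK alt albe _ _ _ il fi.
by apply: (image_traced (al := al)) il fi.
Qed.

Lemma chain_image_lab i f : img i f -> q f = lab i.
Proof. exact: image_lab. Qed.

End Moves.

End Coloring.
End LabelledGraph.

Import Order.TTheory GRing.Theory Num.Theory.
Import numFieldNormedType.Exports.
Local Open Scope ring_scope.

(** * Near-optimal partial colourings *)

Section FiniteMeasure.
Context d (Z : measurableType d) (R : realType) (lam : {measure set Z -> \bar R}).
Hypothesis lam_le1 : (lam setT <= 1)%E.

Definition rmeas (A : set Z) : R := fine (lam A).

Lemma rmeas_fin A : measurable A -> lam A \is a fin_num.
Proof.
move=> mA; rewrite ge0_fin_numE//; apply: (@le_lt_trans _ _ (lam setT)).
  by apply: le_measure; rewrite ?inE.
exact: le_lt_trans lam_le1 (ltry _).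
Qed.

Lemma rmeas_ge0 A : 0 <= rmeas A. Proof. exact: fine_ge0. Qed.

Lemma rmeas_le A B : measurable A -> measurable B -> A `<=` B -> rmeas A <= rmeas B.
Proof.
move=> mA mB AB; apply: fine_le; rewrite ?rmeas_fin//.
by apply: le_measure; rewrite ?inE.
Qed.

Lemma rmeasD A B : measurable A -> measurable B -> B `<=` A ->
  rmeas (A `\` B) = rmeas A - rmeas B.
Proof.
move=> mA mB BA; rewrite /rmeas measureD//; last by rewrite ltey_eq rmeas_fin.
by rewrite (setIidr BA) fineB ?rmeas_fin.
Qed.

Lemma rmeasU A B : measurable A -> measurable B ->
  rmeas (A `|` B) <= rmeas A + rmeas B.
Proof.
move=> mA mB; rewrite -fineD ?rmeas_fin//; apply: fine_le.
- by rewrite rmeas_fin//; exact: measurableU.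
- by rewrite fin_numD !rmeas_fin.
- exact: measureU2.
Qed.

Lemma rmeas_cover (I : finType) (F : I -> set Z) A : measurable A ->
  (forall i, measurable (F i)) -> (forall z, A z -> exists i, F i z) ->
  rmeas A <= \sum_i rmeas (F i).
Proof.
move=> mA mF cov; apply: (@le_trans _ _ (rmeas (\big[setU/set0]_i F i))).
  apply: rmeas_le => //; first exact: bigsetU_measurable.
  by move=> z /cov[i Fi]; rewrite -bigcup_seq; exists i => //=; exact: mem_index_enum.
have : measurable (\big[setU/set0]_i F i) /\
    rmeas (\big[setU/set0]_i F i) <= \sum_i rmeas (F i); last by case.
elim/big_ind2: _ => //; first by rewrite /rmeas measure0.
move=> B b C c [mB Bb] [mC Cc]; split; first exact: measurableU.
exact: le_trans (rmeasU mB mC) (lerD Bb Cc).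
Qed.

(** Integrate the number of sets containing [z], which is at most [n], against a measure of mass at
    most one. *)
Lemma sum_rmeas_le (I : finType) (A : I -> set Z) n :
  (forall i, measurable (A i)) ->
  (forall z, (#|[set i | `[< A i z >]]%SET| <= n)%N) ->
  \sum_i rmeas (A i) <= n%:R.
Proof.
move=> mA An.
have H : (\sum_(i : I) lam (A i) <= n%:R%:E * lam setT)%E.
  have -> : (\sum_(i : I) lam (A i) = \int[lam]_z (\sum_(i : I) (\1_(A i) z)%:E))%E.
    rewrite ge0_integral_sum//.
      by apply: eq_bigr => i _; rewrite integral_indic// setIT.
    by move=> i; apply/measurable_EFinP; exact: measurable_indic.
  rewrite -integral_cst//; apply: ge0_le_integral => //.
  - by move=> z _; apply: sume_ge0 => i _; rewrite lee_fin.
  - by apply: emeasurable_sum => i; apply/measurable_EFinP; exact: measurable_indic.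
  move=> z _; rewrite sumEFin lee_fin.
  rewrite (eq_bigr (fun i => ((`[< A i z >] : nat)%:R)%R)); last first.
    by move=> i _; rewrite indicE; congr (_%:R)%R; congr nat_of_bool; rewrite in_setE.
  rewrite -natr_sum ler_nat (leq_trans _ (An z))//.
  rewrite -sum1_card [leqRHS]big_mkcond; apply: leq_sum => i _.
  by rewrite inE; case: asbool.
rewrite -lee_fin -sumEFin (eq_bigr (fun i => lam (A i))); last first.
  by move=> i _; rewrite fineK ?rmeas_fin.
apply: le_trans H _; rewrite -[leRHS]mule1; apply: lee_pmul => //.
Qed.

End FiniteMeasure.

Section FirstIndex.
Context (I : finType) (T : Type) (P : I -> set T).

Definition first_index i : set T :=
  P i `\` \bigcup_(u in [set u | (enum_rank u < enum_rank i)%N]) P u.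

Lemma first_index_ex x i : P i x -> exists k, first_index k x.
Proof.
move=> /asboolP Pix.
case: (arg_minnP (P := fun k => `[< P k x >]) (fun k => enum_rank k : nat) Pix).
move=> k /asboolP Pkx kmin; exists k; split=> // -[u /= uk Pux].
by have := kmin u (asboolT Pux); rewrite leqNgt uk.
Qed.

Lemma first_index_uniq i k x : first_index i x -> first_index k x -> i = k.
Proof.
move=> [Pi ni] [Pk nk]; apply: enum_rank_inj; apply/eqP/negPn/negP.
rewrite neq_ltn => /orP[lt|lt]; first by apply: nk; exists i.
by apply: ni; exists k.
Qed.

End FirstIndex.

Lemma measurable_first_index d (T : measurableType d) (I : finType) (P : I -> set T) :
  (forall i, measurable (P i)) -> forall i, measurable (first_index P i).
Proof.
move=> mP i; apply: measurableD => //; exact: fin_bigcup_measurable.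
Qed.

(** * Holes of a nearly optimal colouring *)

Section Approximation.
Context d (Z : measurableType d) (V : choiceType) (ea eb : Z -> V).
Context (Delta mu : nat) (E : set Z).
Let K := (Delta + mu)%N.
Hypothesis loopless : forall z, E z -> ea z <> eb z.
Hypothesis degE : forall v, exists s : seq Z,
  (size s <= Delta)%N /\ forall z, E z -> inc ea eb z v -> z \in s.
Hypothesis multE : forall v w, v <> w -> exists s : seq Z,
  (size s <= mu)%N /\ forall z, E z -> inc ea eb z v -> inc ea eb z w -> z \in s.
Context (mE : measurable E).
Context (mN : forall D, measurable D -> measurable (nbhd ea eb E D)).
Context (L r : nat) (r_ge : ((Delta + L) + (Delta + L) + 2 <= r)%N).
Context (q : Z -> nat) (mq : forall n, measurable (E `&` q @^-1` [set n])).
Context (q_inj : forall z z', near ea eb E r z z' -> q z = q z' -> z = z').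
Context (M : nat) (q_lt : forall z, E z -> (q z < M)%N).
Context (R : realType) (lam : {measure set Z -> \bar R}).
Hypothesis lam_le1 : (lam setT <= 1)%E.

Let m := rmeas lam.
Let borel_coloring := borel_coloring ea eb Delta mu E.
Let holes c := E `&` c @^-1` [set K].
Let C := trace_size Delta mu.

(** One bound for labels, colours and [j], so that a single ordinal type holds every entry of a
    chain type. *)
Let B := (M + K + (Delta + L))%N.

Let M_le : (M <= B)%N. Proof. by rewrite /B -addnA leq_addr. Qed.

Let K_le : (K <= B)%N. Proof. by rewrite /B addnAC leq_addl. Qed.

Let DL_le : (Delta + L <= B)%N. Proof. by rewrite /B leq_addl. Qed.

(** The components are the sequence of labels and colours, then [j], [al] and [be], then the final
    colour of a terminating chain. *)
Let chain_type := ((Delta + L).-bseq ('I_B.+1 * 'I_B.+1) *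
  ('I_B.+1 * 'I_B.+1 * 'I_B.+1) * option 'I_B.+1)%type.

Let lab (t : chain_type) i : nat := (nth (ord0, ord0) t.1.1 i).1.
Let col (t : chain_type) i : nat := (nth (ord0, ord0) t.1.1 i).2.
Let len (t : chain_type) := (size t.1.1).-1.
Let jay (t : chain_type) : nat := t.1.2.1.1.
Let al (t : chain_type) : nat := t.1.2.1.2.
Let be (t : chain_type) : nat := t.1.2.2.
Let fin (t : chain_type) : option nat := omap val t.2.
Let wf t := chain_data Delta mu L (lab t) (col t) (len t) (jay t) (al t) (be t) (fin t).

Let r2 : (1 < r)%N. Proof. by lia. Qed.

Section OneColoring.
Context (c : Z -> nat) (c_good : borel_coloring c).

Let dom t := chain_dom ea eb E q c (lab t) (col t) (len t) (jay t) (be t) (fin t) 0.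

Lemma chain_type_ex e : holes c e -> exists t, wf t /\ dom t e.
Proof.
move=> [Ee /= ce].
have [es [j [a [b [ob [[esL esE jL aK bK] H]]]]]] :=
  chain_data_ex q_inj c_good r_ge loopless degE multE Ee ce.
have [_ cK _] := c_good.
pose w := [seq (inord (q f) : 'I_B.+1, inord (c f) : 'I_B.+1) | f <- es].
have wL : (size w <= Delta + L)%N by rewrite size_map.
pose t ot : chain_type := (Bseq wL, (inord j, inord a, inord b), ot).
have sw : size w = size es by rewrite size_map.
have labE ot i : (i < size es)%N -> lab (t ot) i = q (nth e es i) /\
    col (t ot) i = c (nth e es i).
  move=> ies; have Ei := esE _ (mem_nth e ies).
  rewrite /lab /col /= /w (nth_map e)//=; split; rewrite inordK//.
    by rewrite ltnS ltnW// (leq_trans (q_lt Ei)).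
  by rewrite ltnS (leq_trans (cK _ Ei)).
have jE ot : jay (t ot) = j by rewrite /jay /= inordK// ltnS (leq_trans jL).
have aE ot : al (t ot) = a by rewrite /al /= inordK// ltnS (leq_trans aK).
have bE ot : be (t ot) = b by rewrite /be /= inordK// ltnS (leq_trans bK).
have lE ot : len (t ot) = (size es).-1 by rewrite /len /= sw.
have [ot otE] : exists ot : option 'I_B.+1, omap val ot = ob.
  case: ob H => [g|] H; last by exists None.
  have [/cd_end/(_ g erefl) gK _] := H _ _ (labE None).
  by exists (Some (inord g)) => /=; rewrite inordK// ltnS ltnW// (leq_trans gK).
exists (t ot); have := H _ _ (labE ot).
by rewrite /wf /dom jE aE bE lE [fin _]otE.
Qed.

Let typed t : set Z := [set e | holes c e /\ (wf t /\ dom t e)].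

(** A hole may fit several types; taking the first one makes the classes disjoint. *)
Let chosen t : set Z := first_index typed t.

Lemma measurable_holes : measurable (holes c).
Proof. by have [mc _ _] := c_good; exact: mc. Qed.

Lemma measurable_typed t : measurable (typed t).
Proof.
apply: (measurableI _ _ measurable_holes); have [w|w] := pselect (wf t); last first.
  by rewrite [X in measurable X](_ : _ = set0)//; apply/seteqP; split=> e //= [].
rewrite [X in measurable X](_ : _ = dom t); last first.
  by apply/seteqP; split=> e //= [].
exact: (measurable_chain_dom mE mN mq q_inj c_good _ _ _ _ _ _ r2).
Qed.

Lemma measurable_chosen t : measurable (chosen t).
Proof. exact: measurable_first_index measurable_typed t. Qed.

Lemma chosen_ex e : holes c e -> exists t, chosen t e.
Proof.
by move=> he; have [t tP] := chain_type_ex he; apply: (@first_index_ex _ _ typed e t).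
Qed.

Lemma chosen_uniq t u e : chosen t e -> chosen u e -> t = u.
Proof. exact: first_index_uniq. Qed.

Lemma chosen_wf t e : chosen t e -> wf t.
Proof. by move=> [[_ []]]. Qed.

Lemma chosen_dom t : chosen t `<=` dom t.
Proof. by move=> e [[_ []]]. Qed.

Let img t i := chain_image ea eb E q c (lab t) (col t) (len t) (jay t) (be t) (fin t)
  (chosen t) i.

Let long_img (p : chain_type * 'I_L) : set Z :=
  [set f | wf p.1 /\ fin p.1 = None] `&` img p.1 p.2.

Lemma measurable_img t i : measurable (img t i).
Proof.
exact: (measurable_chain_image mE mN mq q_inj c_good _ _ _ _ _ _ r2
  (measurable_chosen t)).
Qed.

Lemma measurable_long_img p : measurable (long_img p).
Proof.
apply: measurableI; last exact: measurable_img.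
have [w|w] := pselect (wf p.1 /\ fin p.1 = None).
  by rewrite [X in measurable X](_ : _ = setT)//; apply/seteqP; split.
by rewrite [X in measurable X](_ : _ = set0)//; apply/seteqP; split.
Qed.

(** Send a pair to a hole whose chain reaches [f] there. The hole determines the type, the classes
    being disjoint, and the label of [f] then determines the stage, so this is injective. Its values
    are traced by [f]. *)
Lemma long_img_mult f : (#|[set p | `[< long_img p f >]]%SET| <= C)%N.
Proof.
have [_ _ c_prop] := c_good.
have [s [sC sP]] := small_traced degE c_prop f.
have /choice[tr trP] p : exists e, long_img p f ->
    chosen p.1 e /\ traced ea eb Delta mu E c f e.
  have [[[w o] fi]|n] := pselect (long_img p f); last by exists f.
  have pl : (p.2 <= len p.1)%N by exact: leq_trans (ltnW (ltn_ord _)) (cd_long w o).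
  have [e se tfe] := chain_image_traced q_inj r_ge w (@chosen_dom p.1) pl fi.
  by exists e.
have memP p : p \in enum [set p | `[< long_img p f >]]%SET -> long_img p f.
  by rewrite mem_enum finset.in_set => /asboolW.
rewrite cardE -(size_map tr); apply: leq_trans sC; apply: uniq_leq_size.
  rewrite map_inj_in_uniq ?enum_uniq// => p p' /memP pf /memP pf' e.
  have [cp _] := trP p pf; have [cp' _] := trP p' pf'; rewrite e in cp.
  have t12 := chosen_uniq cp cp'.
  case: p p' t12 pf pf' {e cp cp'} => [t i] [t' i'] /= <- [[w o] fi] [_ fi'].
  congr pair; apply: val_inj => /=.
  have lL (k : 'I_L) : (k <= len t)%N.
    exact: leq_trans (ltnW (ltn_ord k)) (cd_long w o).
  apply: (cd_inj w (lL i) (lL i')).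
  by rewrite -(chain_image_lab (@chosen_dom t) fi) -(chain_image_lab (@chosen_dom t) fi').
move=> _ /mapP[p /memP/trP[[[[Ee _] _] _] te] ->].
exact: sP.
Qed.

(* Moving the holes in [chosen t] along their chains yields a competitor of [c]. *)
Lemma chain_deficit (dl : R) : 0 <= dl ->
  (forall c', borel_coloring c' -> m (holes c) - dl <= m (holes c')) ->
  forall t, L%:R * m (chosen t) <= \sum_(i < L) m (long_img (t, i)) + L%:R * dl.
Proof.
move=> dl0 opt t; have mt := measurable_chosen t; have mh := measurable_holes.
have sub : chosen t `<=` holes c by move=> e [[]].
have gain c' A : borel_coloring c' -> measurable A -> holes c' `<=` (holes c `\` chosen t) `|` A ->
    m (chosen t) <= m A + dl.
  move=> gc' mA hA; have := opt _ gc'.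
  have mh' : measurable (holes c') by case: gc' => mc' _ _; exact: mc'.
  have := rmeas_le lam_le1 mh' (measurableU _ _ (measurableD mh mt) mA) hA.
  have := rmeasU lam_le1 (measurableD mh mt) mA.
  rewrite (rmeasD lam_le1 mh mt sub) -/m; lra.
have [w|w] := pselect (wf t); last first.
  have -> : chosen t = set0 by rewrite -subset0 => e /chosen_wf.
  rewrite /m /rmeas measure0 mulr0 addr_ge0 ?mulr_ge0//.
  by apply: sumr_ge0 => i _; exact: rmeas_ge0.
case tE : (fin t) => [g|].
  (* A terminating type loses all its holes, so its class has measure at most [dl]. *)
  have [|c' gc' hc'] := chain_finish mE mN mq q_inj c_good r_ge w mt (@chosen_dom t).
    by rewrite tE.
  rewrite -[leLHS]add0r lerD//.
    by apply: sumr_ge0 => i _; exact: rmeas_ge0.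
  rewrite ler_wpM2l// -[leRHS]add0r -(_ : m set0 = 0); last by rewrite /m /rmeas measure0.
  by apply: (gain c') => //; rewrite setU0.
have -> : \sum_(i < L) m (long_img (t, i)) = \sum_(i < L) m (img t i).
  apply: eq_bigr => i _; congr m; apply/seteqP; split=> f; first by case.
  by move=> fi; split.
have natM (x : R) : L%:R * x = \sum_(i < L) x by rewrite sumr_const card_ord mulr_natl.
rewrite !natM -big_split /=.
apply: ler_sum => i _.
have il : (i <= len t)%N by exact: leq_trans (ltnW (ltn_ord i)) (cd_long w tE).
have [c' gc' hc'] := chain_move mE mN mq q_inj c_good r_ge w mt (@chosen_dom t) il.
exact: gain gc' (measurable_img t i) hc'.
Qed.

(** Summed over types and stages, the measures of the images contribute at most [C] for every [L];
    the number of types enters only through the error term. *)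
Lemma holes_le (dl : R) : 0 <= dl ->
  (forall c', borel_coloring c' -> m (holes c) - dl <= m (holes c')) ->
  L%:R * m (holes c) <= C%:R + L%:R * #|{: chain_type}|%:R * dl.
Proof.
move=> dl0 opt.
have cov : m (holes c) <= \sum_t m (chosen t).
  by apply: rmeas_cover; [|exact: measurable_holes|exact: measurable_chosen
    |exact: chosen_ex].
apply: le_trans (ler_wpM2l (ler0n _ _) cov) _; rewrite mulr_sumr.
apply: le_trans (ler_sum _ (fun t _ => chain_deficit dl0 opt t)) _.
rewrite big_split /= sumr_const -[X in _ + X]mulr_natl mulrA [X in _ + X * _]mulrC.
rewrite lerD2r pair_bigA /=.
apply: le_trans (sum_rmeas_le lam_le1 measurable_long_img long_img_mult).
by apply: ler_sum => -[t i] _.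
Qed.

End OneColoring.

Lemma few_holes_ex (eta : R) : 0 < eta ->
  exists2 c, borel_coloring c & L%:R * m (holes c) <= C%:R + eta.
Proof.
move=> eta0; pose N : R := L%:R * #|{: chain_type}|%:R.
have N0 : 0 <= N by rewrite mulr_ge0.
(* This keeps the error [N * dl] below [eta]; the [+ 1] covers [N = 0]. *)
pose dl := eta / (N + 1).
have N1 : 0 < N + 1 by lra.
have dl0 : 0 < dl by rewrite divr_gt0.
pose W := [set m (holes c) | c in borel_coloring].
have W_inf : has_inf W.
  split; last by exists 0 => _ [c _ <-]; exact: rmeas_ge0.
  (* Leaving every edge uncoloured is a competitor. *)
  exists (m (holes (fun=> K))), (fun=> K) => //; split=> // a.
  have [->|aK] := eqVneq a K.
    by rewrite [X in measurable X](_ : _ = E)//; apply/seteqP; split=> z //= [].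
  rewrite [X in measurable X](_ : _ = set0)//; apply/seteqP; split=> z //= [_ Ka].
  by rewrite Ka eqxx in aK.
have [_ [c gc <-] cinf] := inf_adherent dl0 W_inf.
exists c => //; apply: le_trans (holes_le gc (ltW dl0) _) _.
  move=> c' gc'; have := ge_inf W_inf.2 (ex_intro2 _ _ c' gc' erefl).
  by move: cinf; rewrite -/(holes c); lra.
rewrite lerD2l -/N /dl mulrA ler_pdivrMr//; nra.
Qed.

End Approximation.

(** * Compact subgraphs and measurable projections *)

Section FiniteMeasureLimits.
Context d (Z : measurableType d) (R : realType) (lam : {measure set Z -> \bar R}).
Hypothesis lam_le1 : (lam setT <= 1)%E.
Let m := rmeas lam.

Lemma rmeas_bigcup_approx (F : nat -> set Z) (eps : R) : 0 < eps ->
  (forall n, measurable (F n)) ->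
  exists N, m (\bigcup_n F n `\` \bigcup_(n in [set n | (n < N)%N]) F n) <= eps.
Proof.
move=> eps0 mF; pose G N := \bigcup_n F n `\` \bigcup_(n in [set n | (n < N)%N]) F n.
have mG N : measurable (G N).
  by apply: measurableD; [exact: bigcupT_measurable | exact: bigcup_measurable].
have G0 : \bigcap_n G n = set0.
  rewrite -subset0 => z Gz; have [[n _ Fn] _] := Gz 0%N I.
  by have [_] := Gz n.+1 I; apply; exists n => /=.
have ndG : nonincreasing_seq G.
  apply/nonincreasing_seqP => n; apply/subsetPset => z [Uz nz]; split=> //.
  by move=> [k /= kn Fk]; apply: nz; exists k => //=; exact: ltnW.
have : lam \o G @ \oo --> (0 : \bar R)%E.
  rewrite -(measure0 lam) -G0; apply: nonincreasing_cvg_mu => //.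
    by rewrite ltey_eq (rmeas_fin lam_le1).
  by rewrite G0.
move=> /fine_cvgP[_ /cvgrPdist_le /(_ eps eps0)[N _ /(_ N)/=]].
rewrite leqnn sub0r normrN => /(_ isT) H; exists N.
exact: le_trans (ler_norm _) H.
Qed.

Lemma rmeas_bigcup_le (F : nat -> set Z) (eps : R) : 0 <= eps ->
  (forall n, measurable (F n)) ->
  (forall n, m (F n) <= eps / (2 ^ n.+1)%:R) -> m (\bigcup_n F n) <= eps.
Proof.
move=> eps0 mF Fe; have mU := bigcupT_measurable _ mF.
rewrite -lee_fin fineK ?(rmeas_fin lam_le1)//.
apply: le_trans (epsilon_trick0 predT eps0).
apply: le_trans (measure_sigma_subadditive _ mF mU (@subset_refl _ _)) _.
apply: lee_nneseries => // n _.
by rewrite -[leLHS]fineK ?(rmeas_fin lam_le1)// lee_fin; exact: Fe.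
Qed.

End FiniteMeasureLimits.

(** * The topology of a countable code through ultrafilter limits *)

Section UltraLimits.
Context (F0 : set_system nat) (F0_ultra : UltraFilter F0).

Let F0_filter : ProperFilter F0 := ultra_proper.

(** This takes the place of passing to a subsequence: an ultrafilter decides for one of finitely
    many sets. *)
Lemma ultra_bigcup (N : nat) (A : nat -> set nat) :
  F0 [set n | exists2 i, (i < N)%N & A i n] -> exists2 i, (i < N)%N & F0 (A i).
Proof.
elim: N => [|N IH] H.
  by case: (@filter_not_empty _ F0 _); apply: filterS H => n [].
have [AN|AN] := in_ultra_setVsetC (A N) F0_ultra; first by exists N.
have [|i iN Ai] := IH; last by exists i => //; exact: ltnW.
apply: filterS (filterI H AN) => n [[i + Ai] nA].
rewrite ltnS leq_eqVlt => /orP[/eqP iN|iN]; last by exists i.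
by case: nA; rewrite -iN.
Qed.

Lemma ultra_or (A B : set nat) : F0 [set n | A n \/ B n] -> F0 A \/ F0 B.
Proof.
move=> H; have [?|nA] := in_ultra_setVsetC A F0_ultra; first by left.
by right; apply: filterS (filterI H nA) => n [[]].
Qed.

Section Coding.
Context (T : Type) (W : nat -> set T).

(* Convergence along [F0] for the topology generated by the sets [W i] and their
   complements. *)
Definition ultralimit (u : nat -> T) z :=
  forall i, F0 [set n | W i (u n) <-> W i z].

Definition ultraclosed (A : set T) :=
  forall u z, ultralimit u z -> F0 [set n | A (u n)] -> A z.

(** The limit is not asked to lie in [A]: this is relative compactness, inherited by subsets, and
    [ultraclosed] puts the limit in [A]. *)
Definition ultracompact (A : set T) :=
  forall u, F0 [set n | A (u n)] -> exists z, ultralimit u z.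

Lemma ultraclosed0 : ultraclosed set0.
Proof.
by move=> u z _ H; case: (@filter_not_empty _ F0 _); apply: filterS H => n [].
Qed.

Lemma ultraclosed_code i : ultraclosed (W i).
Proof.
move=> u z uz H; have [n [[+ _] Wn]] := filter_ex (filterI (uz i) H); exact.
Qed.

Lemma ultraclosed_codeC i : ultraclosed (~` W i).
Proof.
move=> u z uz H Wz; have [n [[_ WW] nW]] := filter_ex (filterI (uz i) H).
exact/nW/WW.
Qed.

Lemma ultraclosedU A B : ultraclosed A -> ultraclosed B -> ultraclosed (A `|` B).
Proof.
by move=> cA cB u z uz /ultra_or[?|?]; [left; exact: cA uz _|right; exact: cB uz _].
Qed.

Lemma ultraclosedI A B : ultraclosed A -> ultraclosed B -> ultraclosed (A `&` B).
Proof.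
move=> cA cB u z uz H; split; [apply: cA uz _ | apply: cB uz _];
  by apply: filterS H => n [].
Qed.

Lemma ultraclosed_bigcap (I : Type) (A : I -> set T) :
  (forall i, ultraclosed (A i)) -> ultraclosed (\bigcap_i A i).
Proof.
move=> cA u z uz H i _; apply: cA uz _; apply: filterS H => n; exact.
Qed.

Lemma ultraclosed_bigcup N (A : nat -> set T) :
  (forall i, ultraclosed (A i)) -> ultraclosed (\bigcup_(i in [set i | (i < N)%N]) A i).
Proof.
move=> cA u z uz H.
have [i iN Ai] := @ultra_bigcup N (fun i => [set n | A i (u n)]) H.
by exists i => //; exact: cA uz _.
Qed.

Lemma ultracompactS A B : A `<=` B -> ultracompact B -> ultracompact A.
Proof. by move=> AB cB u H; apply: cB; apply: filterS H => n; exact: AB. Qed.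

End Coding.

(** * Inner regularity for the closed sets of a code *)

Section InnerRegular.
Context d (Z : measurableType d) (W : nat -> set Z).
Context (R : realType) (lam : {measure set Z -> \bar R}).
Hypothesis lam_le1 : (lam setT <= 1)%E.
Hypothesis mW : forall n, measurable (W n).
Hypothesis W_gen : forall A : set Z, measurable A -> <<s range W >> A.
Let m := rmeas lam.

Let approx (S : set Z) := forall eps : R, 0 < eps ->
  exists F, [/\ measurable F, ultraclosed W F, F `<=` S & m (S `\` F) <= eps].

(** Closedness is kept by finite unions, so the union is first truncated at a cost of [eps / 2], and
    the approximations of the pieces share the other half. *)
Let approx_bigcup (S : nat -> set Z) : (forall n, measurable (S n)) ->
  (forall n, approx (S n)) -> approx (\bigcup_n S n).
Proof.
move=> mS aS eps eps0; have e2 : 0 < eps / 2 by lra.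
have [N SN] := rmeas_bigcup_approx lam_le1 e2 mS.
have /choice[F FP] n : exists F, [/\ measurable F, ultraclosed W F, F `<=` S n &
    m (S n `\` F) <= eps / 2 / (2 ^ n.+1)%:R].
  by apply: aS; rewrite divr_gt0// ltr0n expn_gt0.
have mF n : measurable (F n) by have [] := FP n.
pose B := \bigcup_(n in [set n | (n < N)%N]) F n.
have mB : measurable B by exact: bigcup_measurable.
exists B; split=> //.
- by apply: ultraclosed_bigcup => n; have [] := FP n.
- by move=> z [n _ Fz]; exists n => //; have [_ _ + _] := FP n; exact.
have mD n : measurable (S n `\` F n) by exact: measurableD.
have mSN : measurable (\bigcup_n S n `\` \bigcup_(n in [set n | (n < N)%N]) S n).
  by apply: measurableD; [exact: bigcupT_measurable | exact: bigcup_measurable].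
have mU := bigcupT_measurable _ mD.
have le1 := rmeas_bigcup_le lam_le1 (ltW e2) mD
  (fun n => let: And4 _ _ _ h := FP n in h).
apply: (@le_trans _ _ (m (\bigcup_n S n `\` \bigcup_(n in [set n | (n < N)%N]) S n) +
    m (\bigcup_n (S n `\` F n)))); last by rewrite [leRHS]splitr lerD.
apply: le_trans (rmeasU lam_le1 mSN mU); apply: (rmeas_le lam_le1).
- by apply: measurableD => //; exact: bigcupT_measurable.
- exact: measurableU.
move=> z [[n _ Sn] nB].
have [[k /= kN Sk]|h] := pselect ((\bigcup_(n in [set n | (n < N)%N]) S n) z).
  by right; exists k => //; split=> // Fk; apply: nB; exists k.
by left; split=> //; exists n.
Qed.

Let approx_bigcap (S : nat -> set Z) : (forall n, measurable (S n)) ->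
  (forall n, approx (S n)) -> approx (\bigcap_n S n).
Proof.
move=> mS aS eps eps0.
have /choice[F FP] n : exists F, [/\ measurable F, ultraclosed W F, F `<=` S n &
    m (S n `\` F) <= eps / (2 ^ n.+1)%:R].
  by apply: aS; rewrite divr_gt0// ltr0n expn_gt0.
have mF n : measurable (F n) by have [] := FP n.
have mD n : measurable (S n `\` F n) by exact: measurableD.
exists (\bigcap_n F n); split.
- exact: bigcapT_measurable.
- by apply: ultraclosed_bigcap => n; have [] := FP n.
- by move=> z Fz n _; have [_ _ + _] := FP n; apply; exact: Fz.
have le1 := rmeas_bigcup_le lam_le1 (ltW eps0) mD
  (fun n => let: And4 _ _ _ h := FP n in h).
apply: le_trans le1; apply: (rmeas_le lam_le1).
- by apply: measurableD; exact: bigcapT_measurable.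
- exact: bigcupT_measurable.
move=> z [Sz nF]; apply: contrapT => h; apply: nF => n _.
by apply: contrapT => nFn; apply: h; exists n => //; split=> //; exact: Sz.
Qed.

(** The measurable sets that are approximable together with their complements form a sigma-algebra.
    It contains every [W n], because codes and their complements are both closed. *)
Lemma inner_ultraclosed (S : set Z) (eps : R) : measurable S -> 0 < eps ->
  exists F, [/\ measurable F, ultraclosed W F, F `<=` S & m (S `\` F) <= eps].
Proof.
move=> mS eps0.
suff [_ aS _] : [/\ measurable S, approx S & approx (~` S)] by exact: aS.
have triv A : measurable A -> ultraclosed W A -> approx A.
  move=> mA cA e e0; exists A; split=> //.
  by rewrite setDv /m /rmeas measure0 ltW.
have sub : <<s range W>> `<=` [set S | [/\ measurable S, approx S & approx (~` S)]].
  apply: smallest_sub; last first.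
    move=> _ [n _ <-]; split=> //.
      by apply: triv => //; exact: ultraclosed_code.
    by apply: triv; [exact: measurableC | exact: ultraclosed_codeC].
  split.
  - split; [exact: measurable0|by apply: triv; [exact: measurable0|exact: ultraclosed0]|].
    by rewrite setC0; apply: triv; [exact: measurableT | move=> u z _ _].
  - move=> A [mA aA aC]; rewrite setTD; split=> //; first exact: measurableC.
    by rewrite setCK.
  - move=> A AP; have mA n : measurable (A n) by case: (AP n).
    have aA n : approx (A n) by case: (AP n).
    have aC n : approx (~` A n) by case: (AP n).
    split; [exact: bigcupT_measurable | exact: approx_bigcup |].
    rewrite setC_bigcup; exact: approx_bigcap (fun n => measurableC (mA n)) aC.
exact: sub (W_gen mS).
Qed.

End InnerRegular.
End UltraLimits.

(** * A code for a standard Borel space *)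

Section StandardCoding.
Context (F0 : set_system nat) (F0_ultra : UltraFilter F0).

Let F0_filter : ProperFilter F0 := ultra_proper.

(** The last clause is tightness of the image of [lam] under [g], for every [g], since one code has
    to serve both endpoint maps. *)
Definition tight_coding (R : realType) d (V : measurableType d) (U : nat -> set V) :=
  [/\ forall n, measurable (U n),
      forall A : set V, measurable A -> <<s range U>> A,
      forall x y, (forall n, U n x <-> U n y) -> x = y &
      forall d' (Z : measurableType d') (lam : {measure set Z -> \bar R})
        (g : Z -> V) (eps : R), (lam setT <= 1)%E -> measurable_fun setT g -> 0 < eps ->
      exists K, [/\ measurable K, ultraclosed F0 U K, ultracompact F0 U K &
        rmeas lam (g @^-1` (~` K)) <= eps]].

Section Polish.
Context (R : realType) d (V : measurableType d).
Context (T : completePseudoMetricType R) (f : V -> T) (D : set T).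
Hypotheses (T_haus : hausdorff_space T) (D_count : countable D) (D_dense : dense D).
Hypotheses (f_bij : bijective f)
  (f_meas : forall A : set V, measurable A <-> <<s @open T >> (f @` A)).

Let pre_img (O : set T) : f @` (f @^-1` O) = O.
Proof.
have [g fg gf] := f_bij; apply/seteqP; split=> [_ [x Ox <-//]|t Ot].
by exists (g t); rewrite /= gf.
Qed.

Let img_pre (A : set V) : f @^-1` (f @` A) = A.
Proof.
apply/seteqP; split=> [x [y Ay /(bij_inj f_bij) <-//]|x Ax]; by exists x.
Qed.

Let q_ex : exists q : nat -> T, D `<=` range q.
Proof.
have /countable_injP[g g_inj] := D_count.
exists (fun n => xget (f point) [set t | D t /\ g t = n]) => t Dt.
exists (g t) => //; case: xgetP => [s _ [Ds gs]|/(_ t)]; last by case.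
by apply: g_inj => //; rewrite inE.
Qed.

Let q := projT1 (cid q_ex).

Let q_dense (O : set T) : open O -> O !=set0 -> exists i, O (q i).
Proof.
move=> oO O0; have [t [Ot Dt]] := D_dense O0 oO.
have [i _ qi] := projT2 (cid q_ex) t Dt.
by exists i; rewrite /q qi.
Qed.

Let rad (k : nat) : R := k.+1%:R^-1.

Let rad_gt0 k : 0 < rad k. Proof. by rewrite invr_gt0. Qed.

Let rad_small (e : R) : 0 < e -> exists k, rad k < e.
Proof.
move=> e0; exists (Num.trunc e^-1); rewrite invf_plt ?posrE//.
exact: truncnS_gt.
Qed.

Let cell (p : nat * nat) : set T := (ball (q p.1) (rad p.2))°.

Let dec (n : nat) : nat * nat := odflt (0, 0)%N (unpickle n).

Let decK p : dec (pickle p) = p. Proof. by rewrite /dec pickleK. Qed.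

Let U n : set V := f @^-1` cell (dec n).

Let cell_cover k t : exists i, cell (i, k) t.
Proof.
have h0 : 0 < rad k / 2 by rewrite divr_gt0.
have [|i qi] := q_dense (@open_interior _ (ball t (rad k / 2))).
  by exists t; exact: nbhsx_ballx.
exists i; apply/nbhs_ballP; exists (rad k / 2) => //= s ts.
rewrite /= [rad k]splitr; apply: (@ball_triangle _ _ t) => //.
by apply: ball_sym; exact: interior_subset qi.
Qed.

(** A point in the closure of a cell around [t] is within three radii of [t], whence a radius below
    [e / 4]. *)
Let cell_base (O : set T) t : nbhs t O ->
  exists n, cell (dec n) t /\ closure (cell (dec n)) `<=` O.
Proof.
move=> /nbhs_ballP[e /= e0 eO]; have e4 : 0 < e / 4 by lra.
have [k ke] := rad_small e4.
have [i it] := cell_cover k t; exists (pickle (i, k)); rewrite decK; split=> //.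
move=> s cs; apply: eO.
have [u [/interior_subset qu su]] := cs _ (nbhsx_ballx s (rad k) (rad_gt0 k)).
have qt := interior_subset it.
apply: (@le_ball _ _ t (rad k + rad k + rad k)); first lra.
apply: (@ball_triangle _ _ u); last exact: ball_sym.
by apply: (@ball_triangle _ _ (q i)) => //; exact: ball_sym.
Qed.

Let open_gen (O : set T) : open O -> <<s range U>> (f @^-1` O).
Proof.
move=> oO.
have -> : f @^-1` O = \bigcup_n (if `[< cell (dec n) `<=` O >] then U n else set0).
  apply/seteqP; split=> [x Ox|x [n _]].
    have [n [nt nO]] := cell_base (open_nbhs_nbhs (conj oO Ox)).
    exists n => //; rewrite asboolT// => s /subset_closure; exact: nO.
  by case: asboolP => // nO /nO.
have [sa0 saC saU] := smallest_sigma_algebra setT (range U).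
apply: saU => n; case: asboolP => // _; apply: sub_sigma_algebra; by exists n.
Qed.

(** This is Ulam's tightness argument with an addition: limits along the code must also respect the
    complements of the open sets [U n]. So each [U n] is exhausted, up to small measure, by finitely
    many cells whose closures it contains. *)
Lemma polish_coding : tight_coding R U.
Proof.
have mU n : measurable (U n).
  apply/f_meas; rewrite pre_img; apply: sub_sigma_algebra; exact: open_interior.
split=> //.
- move=> A /f_meas fA; rewrite -(img_pre A).
  have : <<s @open T>> `<=` [set S | <<s range U>> (f @^-1` S)].
    apply: smallest_sub => [|O oO]; last exact: open_gen.
    have [sa0 saC saU] := smallest_sigma_algebra setT (range U).
    split=> //= [S /saC|S SP]; first by rewrite !setTD preimage_setC.
    by rewrite preimage_bigcup; exact: saU.
  by apply.
- move=> x y xy; apply: (bij_inj f_bij); apply: T_haus => A B Ax By.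
  have [n [nx nA]] := cell_base Ax.
  exists (f y); split; last exact: nbhs_singleton.
  by apply: nA; apply: subset_closure; have [+ _] := xy n; apply.
move=> d' Z lam g eps lam1 mg eps0.
have mgA (A : set V) : measurable A -> measurable (g @^-1` A).
  by move=> mA; rewrite -[X in measurable X]setTI; exact: mg.
have e2 : 0 < eps / 2 by lra.
have e2n n : 0 < eps / 2 / (2 ^ n.+1)%:R by rewrite divr_gt0// ltr0n expn_gt0.
have lt_measurable (A : nat -> set V) N : (forall i, measurable (A i)) ->
    measurable (\bigcup_(i in [set i | (i < N)%N]) A i).
  by move=> mA; exact: bigcup_measurable.
have approx (A : nat -> set V) n : (forall i, measurable (A i)) ->
    exists N, rmeas lam (g @^-1`
        (\bigcup_i A i `\` \bigcup_(i in [set i | (i < N)%N]) A i))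
      <= eps / 2 / (2 ^ n.+1)%:R.
  move=> mA; have [N] := rmeas_bigcup_approx lam1 (e2n n) (fun i => mgA _ (mA i)).
  exists N; rewrite -[X in rmeas lam X]/(g @^-1` (\bigcup_i A i) `\`
    g @^-1` (\bigcup_(i in [set i | (i < N)%N]) A i)).
  by rewrite !preimage_bigcup.
pose Uik (k i : nat) := U (pickle (i, k)).
have mUik k i : measurable (Uik k i) by exact: mU.
pose sub n j : set V :=
  if `[< closure (cell (dec j)) `<=` cell (dec n) >] then U j else set0.
have msub n j : measurable (sub n j) by rewrite /sub; case: ifP.
have csub n j : ultraclosed F0 U (sub n j).
  by rewrite /sub; case: ifP => _; [exact: ultraclosed_code|exact: ultraclosed0].
have /choice[N NP] k := approx (Uik k) k (mUik k).
have /choice[J JP] n := approx (sub n) n (msub n).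
pose K1 k := \bigcup_(i in [set i | (i < N k)%N]) Uik k i.
(* [K1 k] makes the space totally bounded, [K2 n] makes [U n] closed in it. *)
pose K2 n := ~` U n `|` \bigcup_(j in [set j | (j < J n)%N]) sub n j.
have mK1 k : measurable (K1 k) by exact: lt_measurable.
have mK2 n : measurable (K2 n).
  by apply: measurableU; [exact: measurableC|exact: lt_measurable].
have U_all k : \bigcup_i Uik k i = setT.
  apply/seteqP; split=> // x _; have [i ix] := cell_cover k (f x).
  by exists i => //; rewrite /Uik /U /= decK.
have U_sub n : \bigcup_j sub n j = U n.
  apply/seteqP; split=> [x [j _]|x Ux].
    by rewrite /sub; case: asboolP => // jn /(@subset_closure _ (cell (dec j)))/jn.
  have [j [jx jn]] := cell_base (open_nbhs_nbhs (conj (@open_interior _ _) Ux)).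
  by exists j => //; rewrite /sub asboolT.
exists (\bigcap_k K1 k `&` \bigcap_n K2 n); split.
- by apply: measurableI; exact: bigcapT_measurable.
- apply: ultraclosedI; apply: ultraclosed_bigcap => n.
    by apply: ultraclosed_bigcup => i; exact: ultraclosed_code.
  apply: ultraclosedU; first exact: ultraclosed_codeC.
  by apply: ultraclosed_bigcup => j; exact: csub.
(* By [K1] the image of the ultrafilter in [T] contains balls of every radius, so it is Cauchy and
   converges by completeness. *)
- move=> u uK; pose F : set_system T := [set A | F0 [set n | A (f (u n))]].
  have FF : ProperFilter F by exact: (fmap_proper_filter (f \o u)).
  have F_cvg : cvg F.
    apply/cauchy_cvgP/cauchy_exP => e e0; have [k ke] := rad_small e0.
    have [|i _ Fi] := @ultra_bigcup F0 _ (N k) (fun i => [set n | Uik k i (u n)]).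
      by apply: filterS uK => n [/(_ k I)].
    exists (q i); apply: filterS Fi => n; rewrite /Uik /U /= decK => /interior_subset.
    exact: le_ball (ltW ke) _.
  have [g' fg gf] := f_bij; exists (g' (lim F)) => n.
  have [Un|Un] := pselect (U n (g' (lim F))).
    have : F (cell (dec n)).
      apply: F_cvg; apply: open_nbhs_nbhs; split; first exact: open_interior.
      by move: Un; rewrite /U /= gf.
    by apply: (@filterS _ F0 _ [set k | cell (dec n) (f (u k))]) => k Uk; split.
  (* If the limit is outside [U n] while [F0]-many terms are inside, [K2] puts [F0]-many of them in
     one cell whose closure lies in [U n], and this closure contains the limit. *)
  have [Uu|Uu] := in_ultra_setVsetC [set k | U n (u k)] F0_ultra; last first.
    by apply: filterS Uu => k nUk; split.
  have [|j _ Fj] := @ultra_bigcup F0 _ (J n) (fun j => [set k | sub n j (u k)]).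
    by apply: filterS (filterI Uu uK) => k [Uk [_ /(_ n I)[]]].
  exfalso; apply: Un; rewrite /U /= gf; move: Fj; rewrite /sub.
  case: asboolP => [jn Fj|_ Fj]; last first.
    by case: (@filter_not_empty _ F0 _); apply: filterS Fj.
  apply: jn => A At; have FA : F A by exact: F_cvg.
  by have [k [Uj Ak]] := filter_ex (filterI Fj FA); exists k.
have mD1 k : measurable (g @^-1` (~` K1 k)) by apply: mgA; exact: measurableC.
have mD2 n : measurable (g @^-1` (~` K2 n)) by apply: mgA; exact: measurableC.
rewrite setCI !setC_bigcap preimage_setU !preimage_bigcup [leRHS]splitr.
apply: le_trans (rmeasU lam1 _ _) _; [exact: bigcupT_measurable
  |exact: bigcupT_measurable|].
apply: lerD; apply: (rmeas_bigcup_le lam1 (ltW e2)) => // n.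
  by have := NP n; rewrite U_all setTD.
have := JP n; rewrite U_sub; congr (_ <= _); congr (rmeas lam (_ @^-1` _)).
by rewrite setCU setCK.
Qed.

End Polish.

Lemma standard_coding (R : realType) d (V : measurableType d) :
  standard_borel R V -> exists U : nat -> set V, tight_coding R U.
Proof.
move=> [T [f [haus [D cD dD] bf mf]]].
eexists; exact: (polish_coding haus cD dD bf mf).
Qed.

End StandardCoding.

(** * Cylinders of a code *)

Section Cylinders.
Context (T : Type) (W : nat -> set T).

Definition cylinder (b : nat -> bool) N : set T :=
  [set x | forall i, (i < N)%N -> (W i x <-> b i)].

(** Enumerates the cylinders over all finite bit lists; a number coding no list is read as the empty
    list, hence gives the whole space. *)
Definition atom n : set T :=
  let s : seq bool := odflt [::] (unpickle n) in cylinder (nth false s) (size s).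

Lemma atomE (s : seq bool) : atom (pickle s) = cylinder (nth false s) (size s).
Proof. by rewrite /atom pickleK. Qed.

Lemma cylinder_bits b N :
  cylinder b N = \bigcap_(i in [set i | (i < N)%N]) (if b i then W i else ~` W i).
Proof.
apply/seteqP; split=> x /= xb i iN; have := xb i iN; case: (b i) => //=.
  by case=> _; apply.
by case=> H _ /H.
Qed.

End Cylinders.

Lemma atom_isolates (T : eqType) (W : nat -> set T) n (A : set T) x :
  (forall x y, (forall i, W i x <-> W i y) -> x = y) -> small n A ->
  exists k, atom W k x /\ forall y, A y -> atom W k y -> y = x.
Proof.
move=> W_sep [s [_ sA]].
have /choice[i iP] y : exists i, y <> x -> ~ (W i y <-> W i x).
  have [->|yx] := pselect (y = x); first by exists 0%N.
  apply: contrapT => H; apply: yx; apply: W_sep => i; apply: contrapT => ni.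
  by apply: H; exists i.
pose N := (\max_(y <- s) i y).+1.
pose t := mkseq (fun k => `[< W k x >]) N.
have st : size t = N by rewrite size_mkseq.
exists (pickle t); rewrite atomE st; split=> [k kN|y Ay yt].
  by rewrite nth_mkseq//; split=> [?|/asboolP//]; apply/asboolP.
apply: contrapT => yx; apply: (iP y yx).
have iN : (i y < N)%N by rewrite /N ltnS; apply: leq_bigmax_seq => //; exact: sA.
by have := yt _ iN; rewrite nth_mkseq// asboolE.
Qed.


Section MeasurableCylinders.
Context d (T : measurableType d) (W : nat -> set T).
Hypothesis mW : forall n, measurable (W n).

Lemma measurable_cylinder b N : measurable (cylinder W b N).
Proof.
rewrite cylinder_bits; apply: bigcap_measurableType => i _.
by case: (b i) => //; exact: measurableC.
Qed.

Lemma measurable_atom n : measurable (atom W n).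
Proof. exact: measurable_cylinder. Qed.

End MeasurableCylinders.

(** * Measurable images under finite-to-one maps *)

Section Projection.
Context (F0 : set_system nat) (F0_ultra : UltraFilter F0) (F0_free : \oo `<=` F0).
Let F0_filter : ProperFilter F0 := ultra_proper.

Lemma ultraclosed_atom (T : Type) (W : nat -> set T) n : ultraclosed F0 W (atom W n).
Proof.
rewrite /atom cylinder_bits => u z uz H i iN; apply: contrapT => nz.
have [k [/(_ i iN) + ki]] := filter_ex (filterI H (uz i)).
move: nz; case: ifP => _ /=; first by move=> nz /ki.
by move=> /contrapT nz; apply; apply/ki.
Qed.

Context d (V : measurableType d) (U : nat -> set V).
Hypotheses (mU : forall n, measurable (U n))
  (U_sep : forall x y, (forall n, U n x <-> U n y) -> x = y).
Context d' (Z : measurableType d') (W : nat -> set Z).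
Hypotheses
  (W_gen : forall A : set Z, measurable A -> <<s range W>> A)
  (W_sep : forall x y, (forall n, W n x <-> W n y) -> x = y).
Context (g : Z -> V).
Hypothesis g_lim : forall u z, ultralimit F0 W u z -> ultralimit F0 U (g \o u) (g z).

(** [B N] consists of the points that share their first [N] codes with a point of the image, a
    finite union of cylinders. Compactness turns approximate preimages at every depth into a true
    one. *)
Lemma measurable_image_ultraclosed (A : set Z) : ultraclosed F0 W A ->
  ultracompact F0 W A -> measurable (g @` A).
Proof.
move=> cA kA.
pose B N := \bigcup_(s in [set s : {ffun 'I_N -> bool} | exists2 z, A z &
  forall i : 'I_N, U i (g z) <-> s i]) cylinder U (fun i => oapp s false (insub i)) N.
have BP N x : B N x <-> exists2 z, A z & forall i, (i < N)%N -> (U i (g z) <-> U i x).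
  split=> [[s /= [z Az zs] xs]|[z Az zx]].
    exists z => // i iN; have := xs i iN; rewrite insubT /= => xi.
    by split=> [/(zs (Ordinal iN))/xi|/xi/(zs (Ordinal iN))].
  exists [ffun i : 'I_N => `[< U i x >]].
    by exists z => // i; rewrite ffunE asboolE; exact: zx.
  by move=> i iN; rewrite insubT /= ffunE asboolE.
have -> : g @` A = \bigcap_N B N.
  apply/seteqP; split=> [_ [z Az <-] N _|x Bx]; first by apply/BP; exists z.
  have /choice[u uP] N : exists z, A z /\ forall i, (i < N)%N -> (U i (g z) <-> U i x).
    by have /BP[z Az zx] := Bx N I; exists z.
  have uA : F0 [set n | A (u n)] by apply: filterS filterT => n _; have [] := uP n.
  have [z uz] := kA u uA; exists z; first exact: cA uz uA.
  apply: U_sep => i.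
  (* Freeness of [F0] enters here: the image of [u n] is known to agree with [x] on code [i] only
     for [n > i]. *)
  have late : F0 [set n | (i < n)%N] by apply: F0_free; exists i.+1.
  have [n [/= ui lin]] := filter_ex (filterI (g_lim uz i) late).
  by have [_ /(_ i lin) xi] := uP n; rewrite -ui.
apply: bigcapT_measurable => N; apply: fin_bigcup_measurable => [|s _].
  exact: finite_finset.
exact: measurable_cylinder.
Qed.

(** A form of the Lusin-Novikov theorem: atoms split finite fibres, so [E] is the countable union of
    its sets of points that are alone in their fibre within an atom. *)
Lemma measurable_image_finite_fibers (E : set Z) :
    ultraclosed F0 W E -> ultracompact F0 W E ->
    (forall x, exists n, small n [set z | E z /\ g z = x]) ->
  forall D, measurable D -> measurable (g @` (D `&` E)).
Proof.
move=> cE kE fib.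
have mI A : ultraclosed F0 W A -> measurable (g @` (E `&` A)).
  move=> cA; apply: measurable_image_ultraclosed; first exact: ultraclosedI.
  by apply: ultracompactS kE => z [].
(* [g] is injective on each [S n], so that images commute with complements. *)
pose S n := [set z | (E `&` atom W n) z /\
  forall z', (E `&` atom W n) z' -> g z' = g z -> z' = z].
have S_inj n z z' : S n z -> S n z' -> g z = g z' -> z = z'.
  by move=> [_ zS] [z'E _] e; rewrite (zS z').
have mSC n A : ultraclosed F0 W A -> measurable (g @` (A `&` S n)).
  move=> cA; have cn := @ultraclosed_atom Z W n.
  (* A fibre has several points in the atom exactly when some [W i] separates two of them. *)
  have -> : g @` (A `&` S n) = g @` (E `&` (atom W n `&` A)) `\`
      \bigcup_i (g @` (E `&` (atom W n `&` W i)) `&` g @` (E `&` (atom W n `&` ~` W i))).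
    apply/seteqP; split=> [_ [z [Az [[Ez zn] zS]] <-]|x].
      split; first by exists z.
      move=> [i _ [[z1 [E1 [n1 W1]] e1] [z2 [E2 [n2 W2]] e2]]].
      by apply: W2; rewrite /= (zS z2)// -(zS z1).
    move=> [[z [Ez [zn Az]] <-] H]; exists z => //; split=> //; split=> // z' [E' n'] e.
    apply: W_sep => i; apply: contrapT => ni; apply: H; exists i => //.
    have [Wz|Wz] := pselect (W i z); have [Wz'|Wz'] := pselect (W i z').
    - by case: ni.
    - by split; [exists z | exists z'].
    - by split; [exists z' | exists z].
    - by case: ni.
  apply: measurableD; first by apply: mI; exact: ultraclosedI.
  apply: bigcupT_measurable => i.
  apply: measurableI; apply: mI; apply: ultraclosedI => //.
    exact: ultraclosed_code.
  exact: ultraclosed_codeC.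
have mS n D : measurable D -> measurable (g @` (D `&` S n)).
  move=> /W_gen; apply: (@smallest_sub _ _ _ [set D | measurable (g @` (D `&` S n))]).
    split=> /= [|A mA|A mA].
    - by rewrite set0I image_set0.
    - have -> : g @` ((setT `\` A) `&` S n) = g @` (setT `&` S n) `\` g @` (A `&` S n).
        apply/seteqP; split=> [_ [z [[_ nA] Sz] <-]|_ [[z [_ Sz] <-] nA]].
          split; first by exists z.
          by move=> [z' [Az' Sz'] e]; apply: nA; rewrite -(S_inj n z' z).
        by exists z => //; split=> //; split=> // Az; apply: nA; exists z.
      by apply: measurableD => //; apply: mSC => u z _ _.
    - by rewrite setI_bigcupl image_bigcup; exact: bigcupT_measurable.
  by move=> _ [i _ <-]; apply: mSC; exact: ultraclosed_code.
move=> D mD.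
have -> : g @` (D `&` E) = \bigcup_n g @` (D `&` S n).
  apply/seteqP; split=> [_ [z [Dz Ez] <-]|_ [n _ [z [Dz [[Ez _] _]] <-]]];
    last by exists z.
  have [m sm] := fib (g z).
  have [k [zk kP]] := atom_isolates z W_sep sm.
  by exists k => //; exists z => //; split=> //; split=> // z' [E' k'] e; exact: kP.
by apply: bigcupT_measurable => n; exact: mS.
Qed.

End Projection.

(** * Labels that are distinct in balls *)

Section Labels.
Context d (Z : measurableType d) (V : choiceType) (ea eb : Z -> V).
Context (W : nat -> set Z).
Hypotheses (mW : forall n, measurable (W n))
  (W_sep : forall x y, (forall n, W n x <-> W n y) -> x = y).
Context (Delta : nat) (E : set Z).
Hypothesis degE : forall v, exists s : seq Z,
  (size s <= Delta)%N /\ forall z, E z -> inc ea eb z v -> z \in s.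
Context (mE : measurable E).
Context (mN : forall D, measurable D -> measurable (nbhd ea eb E D)).
Context (R : realType) (lam : {measure set Z -> \bar R}).
Hypothesis lam_le1 : (lam setT <= 1)%E.

Definition ball_around r (D : set Z) : set Z := [set z | exists2 z', D z' & near ea eb E r z z'].

Lemma measurable_ball_around r D : measurable D -> measurable (ball_around r D).
Proof.
move=> mD; elim: r => [|r IH].
  rewrite [X in measurable X](_ : _ = E `&` D); first exact: measurableI.
  apply/seteqP; split=> z; first by move=> [z' Dz' [-> Ez']].
  by move=> [Ez Dz]; exists z.
rewrite [X in measurable X](_ : _ = nbhd ea eb E (ball_around r D)); first exact: mN.
apply/seteqP; split=> z /=.
  by move=> [z' Dz' [u [Ez Eu zu] uz']]; split=> //; exists u; split=> //; exists z'.
by move=> [Ez [u [Eu [z' Dz' uz'] zu]]]; exists z' => //; exists u.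
Qed.

Lemma small_near r z : small ((Delta + Delta) ^ r) [set z' | near ea eb E r z z'].
Proof.
elim: r z => [|r IH] z.
  by exists [:: z]; split=> // z' [-> _]; rewrite inE.
rewrite expnS; apply: small_sub (small_bind (small_adj degE z) (fun u _ => IH u)).
by move=> z' [u [Ez Eu zu] uz']; exists u.
Qed.

(** Balls of radius [r] are finite, so each edge is isolated in its ball by an atom; the least
    number of such an atom is its label. Edges of one ball with equal labels are alone in the same
    atom, hence equal. Keeping only the labels below [M] costs little measure. *)
Lemma labelling r (eps : R) : 0 < eps -> exists (E' : set Z) (q : Z -> nat) (M : nat),
  [/\ E' `<=` E, measurable E', rmeas lam (E `\` E') <= eps &
      forall z, E' z -> (q z < M)%N] /\
  [/\ forall D, measurable D -> measurable (nbhd ea eb E' D),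
      forall n, measurable (E' `&` q @^-1` [set n]) &
      forall z z', near ea eb E' r z z' -> q z = q z' -> z = z'].
Proof.
move=> eps0.
pose S n := [set z | (E `&` atom W n) z /\
  forall z', near ea eb E r z z' -> atom W n z' -> z' = z].
have mS n : measurable (S n).
  rewrite [X in measurable X](_ : _ = (E `&` atom W n) `\` \bigcup_i
    ((W i `&` ball_around r (atom W n `&` ~` W i)) `|`
     (~` W i `&` ball_around r (atom W n `&` W i)))).
    have mA := measurable_atom mW n.
    apply: measurableD; first exact: measurableI.
    apply: bigcupT_measurable => i; apply: measurableU; apply: measurableI => //.
    - by apply: measurable_ball_around; apply: measurableI => //; exact: measurableC.
    - exact: measurableC.
    - by apply: measurable_ball_around; exact: measurableI.
  apply/seteqP; split=> z.
    move=> [En zS]; split=> // -[i _ [[Wi [z' [nz' nW] zz']]|[nW [z' [nz' Wi] zz']]]].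
      by apply: nW; rewrite (zS z').
    by apply: nW; rewrite -(zS z').
  move=> [En H]; split=> // z' zz' nz'; apply: W_sep => i; apply: contrapT => ni.
  apply: H; exists i => //.
  have [Wz|Wz] := pselect (W i z); have [Wz'|Wz'] := pselect (W i z').
  - by case: ni.
  - by left; split=> //; exists z'.
  - by right; split=> //; exists z'.
  - by case: ni.
have SE : \bigcup_n S n = E.
  apply/seteqP; split=> [z [n _ [[]]//]|z Ez].
  have [k [zk kP]] := atom_isolates z W_sep (small_near r z).
  by exists k.
have [M SM] := rmeas_bigcup_approx lam_le1 eps0 mS; rewrite SE in SM.
pose E' := \bigcup_(n in [set n | (n < M)%N]) S n.
pose q z := find (fun n => `[< S n z >]) (iota 0 M).
have qP z : E' z -> (q z < M)%N /\ S (q z) z.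
  move=> [n /= nM Sn].
  have h : has (fun n => `[< S n z >]) (iota 0 M).
    by apply/hasP; exists n; [rewrite mem_iota | apply/asboolP].
  have qM : (q z < M)%N by move: h; rewrite has_find size_iota.
  split=> //; have := nth_find 0%N h; rewrite -/(q z) nth_iota// add0n.
  by move=> /asboolP.
have mE' : measurable E' by apply: bigcup_measurable => n _.
have E'E : E' `<=` E by move=> z [n _ [[]]].
exists E', q, M; split; first by split=> // z /qP[].
have near_sub n z z' : near ea eb E' n z z' -> near ea eb E n z z'.
  elim: n z => [|n IH] z /=; first by case=> -> /E'E.
  by move=> [u [/E'E ? /E'E ? zu] /IH uz']; exists u.
split.
- move=> D mD.
  rewrite [X in measurable X](_ : _ = E' `&` nbhd ea eb E (D `&` E')).
    by apply: measurableI => //; apply: mN; exact: measurableI.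
  apply/seteqP; split=> z.
    move=> [Ez [z' [Ez' Dz' zz']]]; split=> //.
    by split; [exact: E'E|exists z'; split=> //; exact: E'E].
  by move=> [Ez [_ [z' [_ [Dz' Ez'] zz']]]]; split=> //; exists z'.
- move=> n; have [nM|Mn] := ltnP n M; last first.
    rewrite [X in measurable X](_ : _ = set0)//.
    apply/seteqP; split=> z //= [/qP[qM _] qn].
    by move: qM; rewrite qn ltnNge Mn.
  rewrite [X in measurable X](_ : _ = S n `\` \bigcup_(k in [set k | (k < n)%N]) S k).
    by apply: measurableD => //; exact: bigcup_measurable.
  apply/seteqP; split=> z /=.
    move=> [Ez qn]; have [qM Sq] := qP z Ez; rewrite -qn; split=> // -[k /= kq Sk].
    have := before_find 0%N kq; rewrite nth_iota ?(ltn_trans kq)// add0n.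
    by move/negbT/asboolPn.
  move=> [Sn nS]; have Ez : E' z by exists n.
  split=> //; have [qM Sq] := qP z Ez; apply/eqP; rewrite eqn_leq; apply/andP; split.
    rewrite leqNgt; apply/negP => nq.
    have := before_find 0%N nq; rewrite nth_iota ?(ltn_trans nq)// add0n.
    by move/negbT/asboolPn.
  by rewrite leqNgt; apply/negP => qn; apply: nS; exists (q z).
- move=> z z' zz1 qq; have zz' := near_sub _ _ _ zz1; have [Ez Ez'] := near_edge zz1.
  have [_ [_ zS]] := qP z Ez; have [_ [[_ z'q] _]] := qP z' Ez'.
  by rewrite (zS z')// qq.
Qed.

End Labels.

Lemma free_ultrafilter : exists F0 : set_system nat, UltraFilter F0 /\ \oo `<=` F0.
Proof. exact: ultraFilterLemma. Qed.

(** * Edges as oriented triples *)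

Section Triples.
Context (F0 : set_system nat) (F0_ultra : UltraFilter F0).
Let F0_filter : ProperFilter F0 := ultra_proper.
Context d (V : measurableType d) (U : nat -> set V).
Let Z := (V * V * nat)%type.

Definition end1 (z : Z) : V := z.1.1.
Definition end2 (z : Z) : V := z.1.2.

Definition triple_code n : set Z :=
  let: (tag, i) := odflt (0, 0)%N (unpickle n) in
  match tag with
  | 0%N => end1 @^-1` U i
  | 1%N => end2 @^-1` U i
  | _ => [set z | z.2 = i]
  end.

Lemma triple_codeE tag i : triple_code (pickle (tag, i)) =
  match tag with
  | 0%N => end1 @^-1` U i | 1%N => end2 @^-1` U i | _ => [set z | z.2 = i]
  end.
Proof. by rewrite /triple_code pickleK. Qed.

Lemma triple_code_ind (P : set Z -> Prop) : (forall i, P (end1 @^-1` U i)) ->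
  (forall i, P (end2 @^-1` U i)) -> (forall i, P [set z | z.2 = i]) ->
  forall n, P (triple_code n).
Proof.
by move=> P1 P2 P3 n; rewrite /triple_code; case: (odflt _ _) => [[|[|tag]] i].
Qed.

Lemma measurable_end1 : measurable_fun setT end1.
Proof. exact: measurableT_comp measurable_fst measurable_fst. Qed.

Lemma measurable_end2 : measurable_fun setT end2.
Proof. exact: measurableT_comp measurable_snd measurable_fst. Qed.

Lemma measurable_triple_code : (forall n, measurable (U n)) ->
  forall n, measurable (triple_code n).
Proof.
move=> mU; apply: triple_code_ind => i.
- by rewrite -[X in measurable X]setTI; exact: measurable_end1.
- by rewrite -[X in measurable X]setTI; exact: measurable_end2.
- have := @measurable_snd _ _ (V * V)%type nat measurableT [set i].
  by rewrite setTI; exact.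
Qed.

Lemma triple_code_sep : (forall x y, (forall n, U n x <-> U n y) -> x = y) ->
  forall z z' : Z, (forall n, triple_code n z <-> triple_code n z') -> z = z'.
Proof.
move=> sep [[x y] k] [[x' y'] k'] H.
have -> : x = x' by apply: sep => i; have := H (pickle (0, i)%N); rewrite triple_codeE.
have -> : y = y' by apply: sep => i; have := H (pickle (1, i)%N); rewrite triple_codeE.
have := H (pickle (2, k)%N); rewrite triple_codeE /= => -[/(_ erefl) e _].
by rewrite e.
Qed.

Lemma triple_code_gen : (forall A : set V, measurable A -> <<s range U>> A) ->
  forall A : set Z, measurable A -> <<s range triple_code>> A.
Proof.
move=> gen.
have [sa0 saC saU] := smallest_sigma_algebra setT (range triple_code).
have comap (T : Type) (g : Z -> T) (G : set (set T)) :
    (forall B, G B -> <<s range triple_code>> (g @^-1` B)) ->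
    forall B, <<s G>> B -> <<s range triple_code>> (g @^-1` B).
  move=> H; apply: smallest_sub => // ; split=> //= [B /saC|B mB].
    by rewrite !setTD preimage_setC.
  by rewrite preimage_bigcup; exact: saU.
have g1 (B : set V) : measurable B -> <<s range triple_code>> (end1 @^-1` B).
  move=> /gen; apply: comap => _ [i _ <-]; apply: sub_sigma_algebra.
  by exists (pickle (0, i)%N) => //; rewrite triple_codeE.
have g2 (B : set V) : measurable B -> <<s range triple_code>> (end2 @^-1` B).
  move=> /gen; apply: comap => _ [i _ <-]; apply: sub_sigma_algebra.
  by exists (pickle (1, i)%N) => //; rewrite triple_codeE.
have g3 (B : set nat) : <<s range triple_code>> ((snd : Z -> nat) @^-1` B).
  have -> : (snd : Z -> nat) @^-1` B =
      \bigcup_i (if `[< B i >] then [set z : Z | z.2 = i] else set0).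
    apply/seteqP; split=> [z Bz|z [i _]]; first by exists z.2 => //; rewrite asboolT.
    by case: asboolP => // Bi e; rewrite /preimage /= e.
  apply: saU => i; case: asboolP => // _; apply: sub_sigma_algebra.
  by exists (pickle (2, i)%N) => //; rewrite triple_codeE.
have g12 (B : set (V * V)) : measurable B ->
    <<s range triple_code>> ((fst : Z -> V * V) @^-1` B).
  apply: comap => C [[B1 mB1 <-]|[B1 mB1 <-]]; rewrite setTI; [exact: g1|exact: g2].
move=> A; rewrite -[A]/((fun z : Z => z) @^-1` A).
apply: comap => C [[B mB <-]|[B mB <-]].
  by rewrite setTI; exact: g12.
by rewrite setTI; exact: g3.
Qed.

Lemma triple_lim1 u z : ultralimit F0 triple_code u z ->
  ultralimit F0 U (end1 \o u) (end1 z).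
Proof. by move=> uz i; have := uz (pickle (0, i)%N); rewrite triple_codeE. Qed.

Lemma triple_lim2 u z : ultralimit F0 triple_code u z ->
  ultralimit F0 U (end2 \o u) (end2 z).
Proof. by move=> uz i; have := uz (pickle (1, i)%N); rewrite triple_codeE. Qed.

Lemma triple_closed1 K : ultraclosed F0 U K -> ultraclosed F0 triple_code (end1 @^-1` K).
Proof. by move=> cK u z /triple_lim1 uz H; exact: cK uz H. Qed.

Lemma triple_closed2 K : ultraclosed F0 U K -> ultraclosed F0 triple_code (end2 @^-1` K).
Proof. by move=> cK u z /triple_lim2 uz H; exact: cK uz H. Qed.

Lemma triple_compact K1 K2 p : ultracompact F0 U K1 -> ultracompact F0 U K2 ->
  ultracompact F0 triple_code
    (end1 @^-1` K1 `&` end2 @^-1` K2 `&` [set z | (z.2 < p)%N]).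
Proof.
move=> k1 k2 u H.
have [|x ux] := k1 (end1 \o u); first by apply: filterS H => n [[]].
have [|y uy] := k2 (end2 \o u); first by apply: filterS H => n [[]].
have [|k _ uk] := @ultra_bigcup F0 F0_ultra p (fun k => [set n | (u n).2 = k]).
  by apply: filterS H => n [_ /= lt]; exists (u n).2.
exists (x, y, k).
apply: (@triple_code_ind (fun S => F0 [set n | S (u n) <-> S (x, y, k)])) => i;
  [exact: ux|exact: uy|].
by apply: filterS uk => n /= ->.
Qed.

End Triples.

(** * Approximate colouring of a graph of triples *)

Section TripleGraph.
Context (R : realType) d (V : measurableType d) (hV : standard_borel R V).
Let Z := (V * V * nat)%type.
Context (Delta mu p : nat) (E : set Z) (mE : measurable E).
Hypothesis loopless : forall z, E z -> end1 z <> end2 z.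
Hypothesis degE : forall v, small Delta [set z | E z /\ inc (@end1 _ V) (@end2 _ V) z v].
Hypothesis multE : forall v w, v <> w -> small mu
  [set z | E z /\ inc (@end1 _ V) (@end2 _ V) z v /\ inc (@end1 _ V) (@end2 _ V) z w].
Hypothesis labE : forall z, E z -> (z.2 < p)%N.
Context (lam : {measure set Z -> \bar R}).
Hypothesis lam_le1 : (lam setT <= 1)%E.

(* By inner regularity all but a small part of [E] is compact for the topology
   generated by the codes; projections of it are then measurable. *)
Lemma compact_subgraph (eps : R) : 0 < eps -> exists E1 : set Z,
  [/\ E1 `<=` E, measurable E1, rmeas lam (E `\` E1) <= eps,
      forall D, measurable D -> measurable (nbhd (@end1 _ V) (@end2 _ V) E1 D) &
      exists W : nat -> set Z, (forall n, measurable (W n)) /\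
        forall z z', (forall n, W n z <-> W n z') -> z = z'].
Proof.
(* One third is lost for the closed part of [E], and one for the compact set of each endpoint
   map. *)
move=> eps0; have e3 : 0 < eps / 3 by lra.
have [F0 [F0_ultra F0_free]] := free_ultrafilter.
have [U [mU U_gen U_sep U_tight]] := standard_coding F0_ultra hV.
pose W := triple_code U.
have mW := measurable_triple_code mU.
have W_gen := triple_code_gen U_gen.
have W_sep := triple_code_sep U_sep.
have [F [mF cF FE Fe]] := inner_ultraclosed F0_ultra lam_le1 mW W_gen mE e3.
have [K1 [mK1 cK1 kK1 K1e]] := U_tight _ _ lam _ _ lam_le1 (@measurable_end1 _ V) e3.
have [K2 [mK2 cK2 kK2 K2e]] := U_tight _ _ lam _ _ lam_le1 (@measurable_end2 _ V) e3.
have mk1 (K : set V) : measurable K -> measurable ((@end1 _ V) @^-1` K).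
  by move=> mK; rewrite -[X in measurable X]setTI; exact: measurable_end1.
have mk2 (K : set V) : measurable K -> measurable ((@end2 _ V) @^-1` K).
  by move=> mK; rewrite -[X in measurable X]setTI; exact: measurable_end2.
pose E1 := F `&` ((@end1 _ V) @^-1` K1 `&` (@end2 _ V) @^-1` K2).
have mE1 : measurable E1.
  by apply: measurableI => //; apply: measurableI; [exact: mk1|exact: mk2].
have E1E : E1 `<=` E by move=> z [/FE].
have cE1 : ultraclosed F0 W E1.
  apply: ultraclosedI => //; apply: ultraclosedI.
    exact: triple_closed1.
  exact: triple_closed2.
have kE1 : ultracompact F0 W E1.
  have kK := triple_compact F0_ultra (p := p) kK1 kK2.
  apply: (ultracompactS F0_ultra _ kK) => z [Fz [z1 z2]].
  by split=> //; exact/labE/FE.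
have fib (g : Z -> V) : (forall z, inc (@end1 _ V) (@end2 _ V) z (g z)) ->
    forall x, exists n, small n [set z | E1 z /\ g z = x].
  move=> gi x; exists Delta; apply: small_sub (degE x) => z [/E1E Ez <-]; split=> //.
exists E1; split=> //; last by exists W.
  have mc1 := mk1 _ (measurableC mK1); have mc2 := mk2 _ (measurableC mK2).
  have mEF := measurableD mE mF.
  apply: (@le_trans _ _ (rmeas lam ((E `\` F) `|`
      ((@end1 _ V) @^-1` (~` K1) `|` (@end2 _ V) @^-1` (~` K2))))).
    apply: (rmeas_le lam_le1); first exact: measurableD.
      by apply: measurableU => //; exact: measurableU.
    move=> z [Ez nE1]; apply: contrapT => H; apply: nE1; split.
      by apply: contrapT => nF; apply: H; left.
    by split; apply: contrapT => nK; apply: H; right; [left|right].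
  apply: le_trans (rmeasU lam_le1 mEF (measurableU _ _ mc1 mc2)) _.
  have := rmeasU lam_le1 mc1 mc2; lra.
move=> D mD.
have m1 := measurable_image_finite_fibers F0_ultra F0_free mU U_sep W_gen W_sep
  (@triple_lim1 F0 _ V U) cE1 kE1 (fib _ (fun z => or_introl erefl)) mD.
have m2 := measurable_image_finite_fibers F0_ultra F0_free mU U_sep W_gen W_sep
  (@triple_lim2 F0 _ V U) cE1 kE1 (fib _ (fun z => or_intror erefl)) mD.
have mQ := measurableU _ _ m1 m2.
set Q := (_ `|` _) in mQ.
(* Being adjacent to an edge of [D] means having an end in the set [Q] of ends of such edges, so two
   projections suffice. *)
rewrite [X in measurable X](_ : _ = E1 `&` ((@end1 _ V) @^-1` Q `|` (@end2 _ V) @^-1` Q)).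
  by apply: measurableI => //; apply: measurableU; [exact: mk1|exact: mk2].
apply/seteqP; split=> z.
  move=> [Ez [z' [Ez' Dz' [v [zv z'v]]]]]; split=> //.
  have Qv : Q v by case: z'v => <-; [left|right]; exists z'.
  by case: zv => e; [left|right]; rewrite /preimage /= e.
move=> [Ez H]; split=> //.
have [v zv Qv] : exists2 v, inc (@end1 _ V) (@end2 _ V) z v & Q v.
  by case: H => H; [exists (end1 z) => //; left|exists (end2 z) => //; right].
case: Qv => -[z' [Dz' Ez'] e]; exists z'; split=> //; exists v; split=> //.
  by left.
by right.
Qed.

Lemma approx_coloring_triples (eps : R) : 0 < eps ->
  exists (C : set Z) (c : Z -> nat),
  [/\ measurable C, C `<=` E & rmeas lam (E `\` C) <= eps] /\
  [/\ forall n, measurable (C `&` c @^-1` [set n]),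
      forall z, C z -> (c z < Delta + mu)%N &
      forall z z', C z -> C z' -> adj (@end1 _ V) (@end2 _ V) z z' -> z <> z' ->
        c z <> c z'].
Proof.
move=> eps0; have e3 : 0 < eps / 3 by lra.
have [E1 [E1E mE1 E1e mN1 [W [mW W_sep]]]] := compact_subgraph e3.
have deg_sub (A : set Z) : A `<=` E -> forall v, exists s : seq Z,
    (size s <= Delta)%N /\ forall z, A z -> inc (@end1 _ V) (@end2 _ V) z v -> z \in s.
  move=> AE v; have [s [sD sE]] := degE v; exists s; split=> // z /AE Ez zv.
  exact: sE.
(* The bound of [few_holes_ex] for [eta = 1]; [L] is taken so large that the holes have measure at
   most [eps / 3]. *)
pose B : R := (trace_size Delta mu)%:R + 1.
have [L L0 BL] : exists2 L, (0 < L)%N & B <= L%:R * (eps / 3).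
  exists (Num.trunc (B / (eps / 3))).+1 => //.
  by rewrite -ler_pdivrMr// ltW// truncnS_gt.
(* A chain has at most [Delta + L] edges; any two are joined through its first edge within twice
   that distance, and the 2 leaves room for adjacent edges. *)
pose r := ((Delta + L) + (Delta + L) + 2)%N.
have [E2 [q [M [[E21 mE2 E2e qM] [mN2 mq q_inj]]]]] :=
  labelling mW W_sep (deg_sub _ E1E) mE1 mN1 lam_le1 r e3.
have E2E : E2 `<=` E := subset_trans E21 E1E.
have multE2 v w : v <> w -> exists s : seq Z, (size s <= mu)%N /\
    forall z, E2 z -> inc (@end1 _ V) (@end2 _ V) z v ->
    inc (@end1 _ V) (@end2 _ V) z w -> z \in s.
  move=> vw; have [s [sm sE]] := multE vw; exists s; split=> // z /E2E Ez zv zw.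
  exact: sE.
have [c [mc cK c_prop] cL] := few_holes_ex (fun z Ez => loopless (E2E z Ez))
  (deg_sub _ E2E) multE2 mE2 mN2 (leqnn r) mq q_inj qM lam_le1 (@ltr01 R).
pose H := E2 `&` c @^-1` [set (Delta + mu)%N].
have mH : measurable H by exact: mc.
have He : rmeas lam H <= eps / 3.
  have L0' : 0 < L%:R :> R by rewrite ltr0n.
  by rewrite -(ler_pM2l L0'); apply: le_trans BL.
exists (E2 `\` H), c; split; split.
- exact: measurableD.
- by move=> z [/E2E].
- apply: (@le_trans _ _ (rmeas lam ((E `\` E1) `|` ((E1 `\` E2) `|` H)))).
    have m12 := measurableU _ _ (measurableD mE1 mE2) mH.
    apply: (rmeas_le lam_le1); [|exact: measurableU (measurableD mE mE1) m12|].
      by apply: measurableD => //; exact: measurableD.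
    move=> z [Ez nz]; have [z1|z1] := pselect (E1 z); last by left.
    right; have [z2|z2] := pselect (E2 z); last by left.
    by right; apply: contrapT => nH; apply: nz.
  have m12 := rmeasU lam_le1 (measurableD mE1 mE2) mH.
  have := rmeasU lam_le1 (measurableD mE mE1) (measurableU _ _ (measurableD mE1 mE2) mH).
  lra.
- move=> n; rewrite [X in measurable X](_ : _ = (E2 `&` c @^-1` [set n]) `\` H).
    by apply: measurableD.
  by apply/seteqP; split=> z [[]] //=.
- by move=> z [Ez nH]; rewrite ltn_neqAle cK// andbT; apply/eqP => cz; apply: nH.
- move=> z z' [Ez nH] [Ez' _] zz' nzz' cc; apply: nH; split=> //=.
  by apply/eqP; rewrite eqn_leq cK//= (c_prop z z').
Qed.

End TripleGraph.

(** * Orienting unordered pairs *)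

Section PairOrder.
Context d (V : measurableType d) (U : nat -> set V).
Hypotheses (mU : forall n, measurable (U n))
  (U_sep : forall x y, (forall n, U n x <-> U n y) -> x = y).

(** The lexicographic order of the code sequences, a measurable strict linear order on [V]. *)
Definition code_lt : set (V * V) := [set xy | exists n,
  [/\ forall i, (i < n)%N -> (U i xy.1 <-> U i xy.2), ~ U n xy.1 & U n xy.2]].

Lemma code_lt_total x y : x <> y -> code_lt (x, y) \/ code_lt (y, x).
Proof.
move=> xy; have [n0 n0P] : exists n, ~ (U n x <-> U n y).
  apply: contrapT => H; apply: xy; apply: U_sep => n; apply: contrapT => nn.
  by apply: H; exists n.
have ex : exists n, `[< ~ (U n x <-> U n y) >] by exists n0; apply/asboolP.
case: (ex_minnP ex) => n /asboolP nP nmin.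
have lt i : (i < n)%N -> (U i x <-> U i y).
  move=> i_n; apply: contrapT => ni; have := nmin i (asboolT ni).
  by rewrite leqNgt i_n.
have [Ux|Ux] := pselect (U n x); have [Uy|Uy] := pselect (U n y).
- by case: nP.
- by right; exists n; split=> // i /lt /= h; split=> /h.
- by left; exists n.
- by case: nP.
Qed.

Lemma code_lt_asym x y : code_lt (x, y) -> code_lt (y, x) -> False.
Proof.
move=> [n [/= nlt nx ny]] [m [/= mlt my mx]].
have [nm|mn|e] := ltngtP n m; last by rewrite e in ny.
  by apply: nx; apply/mlt.
by apply: my; apply/nlt.
Qed.

Lemma measurable_code_lt : measurable code_lt.
Proof.
have m1 i : measurable [set xy : V * V | U i xy.1].
  by rewrite -[X in measurable X]setTI; exact: measurable_fst.
have m2 i : measurable [set xy : V * V | U i xy.2].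
  by rewrite -[X in measurable X]setTI; exact: measurable_snd.
rewrite [X in measurable X](_ : _ = \bigcup_n (
    (\bigcap_(i in [set i | (i < n)%N])
      (([set xy : V * V | U i xy.1] `&` [set xy : V * V | U i xy.2]) `|`
       (~` [set xy : V * V | U i xy.1] `&` ~` [set xy : V * V | U i xy.2])))
    `&` ~` [set xy : V * V | U n xy.1] `&` [set xy : V * V | U n xy.2])).
  apply: bigcupT_measurable => n; apply: measurableI => //.
  apply: measurableI; last exact: measurableC.
  apply: bigcap_measurableType => i _; apply: measurableU; apply: measurableI => //;
    exact: measurableC.
apply/seteqP; split=> [xy [n [lt nx ny]]|xy [n _ [[lt nx] ny]]].
  exists n => //; split=> //; split=> // i /= i_n.
  have [H1 H2] := lt i i_n; have [Ux|Ux] := pselect (U i xy.1).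
    by left; split=> //; exact: H1.
  by right; split=> // /H2.
exists n; split=> // i i_n; have := lt i i_n.
by case=> -[/= ? ?]; split.
Qed.

Lemma mk_upair_inj (xy xy' : V * V) : mk_upair xy = mk_upair xy' ->
  xy' = xy \/ xy' = swap xy.
Proof.
case: xy xy' => [x y] [x' y'] /(congr1 val)/= /seteqP[/= s1 s2].
have := s1 x; have := s1 y; have := s2 x'; have := s2 y'; rewrite /swap /=.
move=> /(_ (or_intror erefl)) h1 /(_ (or_introl erefl)) h2.
move=> /(_ (or_intror erefl)) h3 /(_ (or_introl erefl)) h4.
case: h1 h2 h3 h4 => -> [] -> [] e [] e'; subst; by [left|right|left; congr pair].
Qed.

Lemma mk_upair_swap (xy : V * V) : mk_upair (swap xy) = mk_upair xy.
Proof.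
by apply: val_inj; rewrite /= setUC.
Qed.

Lemma mk_upair_surj (u : upair V) : exists xy, mk_upair xy = u.
Proof.
case: u => A Am; have [x [y AE]] := set_mem Am.
by exists (x, y); apply: val_inj; rewrite /= AE.
Qed.

(** A measurable section of [mk_upair]; the order condition is negated so that it also admits the
    degenerate pairs. *)
Definition orient (u : upair V) : V * V :=
  xget point [set xy | mk_upair xy = u /\ ~ code_lt (swap xy)].

Lemma orientP u : mk_upair (orient u) = u /\ ~ code_lt (swap (orient u)).
Proof.
rewrite /orient; case: xgetP => [xy _ //|H].
have [[x y] uE] := mk_upair_surj u.
exfalso; have [lt|nlt] := pselect (code_lt (y, x)); last exact: (H (x, y)).
apply: (H (y, x)); split; first by rewrite -uE -[(y, x)]/(swap (x, y)) mk_upair_swap.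
by move=> /= lt'; exact: code_lt_asym lt lt'.
Qed.

Lemma orient_mk xy :
  orient (mk_upair xy) = if `[< code_lt (swap xy) >] then swap xy else xy.
Proof.
have [e n] := orientP (mk_upair xy).
case: (mk_upair_inj (esym e)) => os; case: asboolP => // lt.
  by case: n; rewrite os.
case: xy e n lt os => [x y] e n lt os; rewrite os /swap /= in n *.
have [->//|xy] := pselect (x = y).
by case: (code_lt_total xy).
Qed.

Lemma measurable_mk_upair : measurable_fun setT (@mk_upair V).
Proof. by move=> _ A. Qed.

(** By the definition of the quotient sigma-algebra it is enough to look in [V * V], where orienting
    is the swap or the identity on two measurable pieces. *)
Lemma measurable_orient : measurable_fun setT orient.
Proof.
move=> _ A mA; rewrite setTI.
have mS (B : set (V * V)) : measurable B -> measurable (@swap V V @^-1` B).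
  by move=> mB; rewrite -[X in measurable X]setTI; exact: measurable_swap.
have mlt := mS _ measurable_code_lt.
suff : measurable (@mk_upair V @^-1` (orient @^-1` A)).
  by rewrite -[X in measurable X -> _]setTI.
rewrite [X in measurable X](_ : _ = (@swap V V @^-1` code_lt `&` @swap V V @^-1` A) `|`
    (A `\` @swap V V @^-1` code_lt)).
  by apply: measurableU; [apply: measurableI => //; exact: mS|exact: measurableD].
by apply/seteqP; split=> xy; rewrite /preimage /= orient_mk;
  case: asboolP => lt; intuition.
Qed.

End PairOrder.

Lemma pushforward_ex d d' (T : measurableType d) (T' : measurableType d')
    (R : realType) (nu : {measure set T -> \bar R}) (s : T -> T') :
  measurable_fun setT s ->
  exists lam : {measure set T' -> \bar R}, forall A, lam A = nu (s @^-1` A).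
Proof. by move=> ms; unshelve eexists (pushforward nu s). Qed.

Lemma counting_small (R : realType) (T : choiceType) (A : set T) n :
  (counting A <= n%:R%:E :> \bar R)%E -> small n A.
Proof.
rewrite /counting; case: asboolP => [finA|_]; last by rewrite leye_eq.
rewrite lee_fin ler_nat => An; exists (finmap.enum_fset (fset_set A)); split=> // x Ax.
by have := in_fset_set finA x; rewrite mem_set.
Qed.

(** Cardinals are integers, so a bound by the supremum is a bound by its integer part. The index
    [i0] makes the supremum nonnegative. *)
Lemma ereal_sup_counting (R : realType) (I : Type) (T : choiceType) (A : I -> set T)
    (i0 : I) : let s := ereal_sup [set counting (A i) | i in setT] : \bar R in
  (s < +oo)%E -> exists N : nat, (N%:R%:E <= s)%E /\ forall i, small N (A i).
Proof.
move=> s soo; have les i : (counting (A i) <= s)%E.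
  by apply: ereal_sup_ubound; exists i.
have s0 : (0 <= s)%E.
  apply: le_trans (les i0).
  by rewrite /counting; case: asboolP; rewrite ?lee_fin ?leey.
have sE : s = (fine s)%:E by rewrite fineK// ge0_fin_numE.
exists (Num.trunc (fine s)); split.
  by rewrite [leRHS]sE lee_fin truncn_le fine_ge0.
move=> i; apply: (@counting_small R).
have : (counting (A i) <= (fine s)%:E)%E by rewrite -sE.
rewrite /counting; case: asboolP => [finA|_]; last by rewrite leye_eq.
by rewrite !lee_fin ler_nat truncn_ge_nat// fine_ge0.
Qed.

(** * Transfer to unordered pairs *)

Section Reduction.
Context (R : realType) d (V : measurableType d) (hV : standard_borel R V).
Context (p : nat) (G : borel_multigraph V p) (Delta mu : nat).
Hypothesis degG : forall x, small Delta [set e | edges G e /\ endpoint e x].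
Hypothesis multG : forall a, small mu [set k | edges G (a, k)].
Context (nu : probability (upair V * nat)%type R) (nuG : nu (edges G) = 1%E).

Lemma ap_colorable_bound : ap_colorable G nu (Delta + mu)%N.
Proof.
(* The triples are coloured up to [eps / 2] because the measure of the coloured set has to exceed
   [1 - eps] strictly. *)
move=> eps eps0; have e2 : 0 < eps / 2 by lra.
have [F0 [F0_ultra _]] := free_ultrafilter.
have [U [mU _ U_sep _]] := standard_coding F0_ultra hV.
pose X := (upair V * nat)%type; pose Z := (V * V * nat)%type.
pose s (e : X) : Z := (orient U e.1, e.2).
pose b (z : Z) : X := (mk_upair z.1, z.2).
have sK e : b (s e) = e.
  by case: e => u k; rewrite /b /s /=; have [-> _] := orientP U u.
have ms : measurable_fun setT s.
  apply: measurable_fun_pair => //.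
  exact: measurableT_comp (measurable_orient mU U_sep) measurable_fst.
have mb : measurable_fun setT b.
  apply: measurable_fun_pair => //.
  exact: measurableT_comp (@measurable_mk_upair _ V) measurable_fst.
have mpre (A : set Z) : measurable A -> measurable (s @^-1` A).
  by move=> mA; rewrite -[X in measurable X]setTI; exact: ms.
(* The image of the edges under the section [s], written so that it is a preimage under [b] minus
   the wrongly oriented triples. *)
pose E : set Z := [set z | edges G (b z) /\ s (b z) = z].
have sE e : edges G e -> E (s e) by move=> Ge; split; rewrite sK.
have mlt := measurable_code_lt mU.
have mE : measurable E.
  have -> : E = b @^-1` edges G `\` fst @^-1` (@swap V V @^-1` code_lt U).
    apply/seteqP; split=> [z [Gz sz]|z [Gz nz]]; split=> //.
      by move=> lt; have [_] := orientP U (mk_upair z.1); apply;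
        move: lt; rewrite -{1}sz.
    case: z Gz nz => xy k Gz nz; rewrite /s /b /= orient_mk//.
    by case: asboolP.
  apply: measurableD.
    by rewrite -[X in measurable X]setTI; apply: mb => //; exact: edges_measurable.
  rewrite -[X in measurable X]setTI; apply: measurable_fst => //.
  by rewrite -[X in measurable X]setTI; exact: measurable_swap.
have endE (z : Z) v : inc (@end1 _ V) (@end2 _ V) z v <-> endpoint (b z) v.
  by split=> [[<-|<-]|[->|->]]; by [left|right].
have loopless z : E z -> end1 z <> end2 z.
  move=> [Gz _] e; have [x [y [xy /seteqP[/= _ sub]]]] := edges_loopless Gz.
  apply: xy; have := sub x (or_introl erefl); have := sub y (or_intror erefl).
  rewrite -[z.1.1]/(end1 z) -[z.1.2]/(end2 z) e.
  by case=> -> [] ->.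
have degE v : small Delta [set z | E z /\ inc (@end1 _ V) (@end2 _ V) z v].
  have [t [tD tE]] := degG v; exists (map s t); rewrite size_map; split=> //.
  move=> z [[Gz sz] /endE zv]; rewrite -sz; apply: map_f; exact: tE.
have multE v w : v <> w -> small mu [set z | E z /\
    inc (@end1 _ V) (@end2 _ V) z v /\ inc (@end1 _ V) (@end2 _ V) z w].
  move=> vw; have [t [tm tE]] := multG (mk_upair (v, w)).
  exists [seq s (mk_upair (v, w), k) | k <- t]; rewrite size_map; split=> //.
  move=> z [[Gz sz] [zv zw]]; have zE : mk_upair z.1 = mk_upair (v, w).
    have [e|e] : z.1 = (v, w) \/ z.1 = swap (v, w).
      by case: z {Gz sz} zv zw => [[x y] k] [] /= ev [] /= ew; subst;
        [case: vw|left|right|case: vw].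
    - by rewrite e.
    - by rewrite e mk_upair_swap.
  by apply/mapP; exists z.2; [apply: tE; rewrite /= -zE|rewrite -zE].
have labE z : E z -> (z.2 < p)%N by move=> [/edges_label].
have [lam lamE] := pushforward_ex nu ms.
have lam1 : (lam setT <= 1)%E.
  by rewrite lamE preimage_setT -[X in (_ <= X)%E](@probability_setT _ _ _ nu).
have [C [c [[mC CE Ce] [mc cK cP]]]] :=
  approx_coloring_triples hV mE loopless degE multE labE lam1 e2.
exists (s @^-1` C), (c \o s); split; split.
- exact: mpre.
- by move=> e /CE[+ _]; rewrite sK.
- have lam_E : rmeas lam E = 1.
    rewrite -[RHS]/(fine 1%E) -nuG /rmeas lamE; congr (fine (nu _)).
    by apply/seteqP; split=> [e [+ _]|e /sE//]; rewrite sK.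
  have := rmeasD lam1 mE mC CE; rewrite lam_E => CeE.
  have : rmeas lam C > 1 - eps by rewrite CeE in Ce; lra.
  by rewrite -lte_fin fineK ?(rmeas_fin lam1)// lamE.
- move=> _ Y _; rewrite [X in measurable X](_ : _ =
      \bigcup_(n in Y) s @^-1` (C `&` c @^-1` [set n])).
    by apply: bigcup_measurable => n _; apply: mpre.
  apply/seteqP; split=> [e [Ce' Ye]|e [n Yn [Ce' cn]]]; first by exists (c (s e)).
  by split=> //; rewrite /preimage /= cn.
- by move=> e /cK.
- move=> e f Ce' Cf [Ge Gf ef [v [ev fv]]]; apply: cP => //.
    by exists v; split; apply/endE; rewrite sK.
  by move=> sef; apply: ef; rewrite -(sK e) sef sK.
Qed.

End Reduction.

Local Open Scope ereal_scope.

Theorem theorem5p2 (R : realType) (d : measure_display) (V : measurableType d)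
    (hV : standard_borel R V) (p : nat) (G : borel_multigraph V p)
    (hG : max_degree G R < +oo)
    (nu : probability (upair V * nat)%type R)
    (nuG : nu (edges G) = 1)
    (hnu : quasi_invariant G nu) :
  chi_AP G nu <= max_degree G R + max_multiplicity G R.
Proof.
have [Delta [DG degG]] := ereal_sup_counting point hG.
have deg0 : 0 <= max_degree G R by apply: le_trans DG; rewrite lee_fin.
have [->|mG] := eqVneq (max_multiplicity G R) +oo.
  by rewrite addey ?leey// -ltNye (lt_le_trans _ deg0).
have moo : max_multiplicity G R < +oo by rewrite ltey.
have [mu [mG' multG]] := ereal_sup_counting point moo.
apply: (@le_trans _ _ (Delta%:R%:E + mu%:R%:E)); last exact: leeD.
rewrite -EFinD -natrD; apply: ereal_inf_lbound; exists (Delta + mu)%N => //.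
exact: (ap_colorable_bound hV degG multG nuG).
Qed.
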